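(* Suppose that $\kappa$ is a regular uncountable cardinal, and $\vec M=\langle M_\beta\mid\beta<\kappa^+\rangle$ is a nice filtration of $H_{\kappa^+}$ that is eventually slow at $\kappa$ and witnesses that $\mathsf{LCC}(\kappa,\kappa^+)$ holds. Suppose further that there is a subset $a\subseteq\kappa$ and a first-order formula $\Theta$ of the language of set theory ($\Theta\in\Sigma_\omega$) which defines a well-order $<_\Theta$ of $H_{\kappa^+}$ via: $x<_\Theta y$ iff $H_{\kappa^+}\models\Theta(x,y,a)$. Then, for every stationary $S\subseteq\kappa$, $\mathrm{Dl}^*_S(\Pi^1_2)$ holds.
   Context: **Nice filtrations.** Let $N$ be a transitive set and $\lambda$ a limit ordinal. A sequence $\vec M=\langle M_\beta\mid\beta<\lambda\rangle$ is a nice filtration of $N$ iff: (1) $\bigcup_{\beta<\lambda}M_\beta=N$; (2) $\alpha<\beta<\lambda$ implies $M_\alpha\in M_\beta$; (3) for every limit ordinal $\beta$ with $0<\beta<\lambda$, $M_\beta=\bigcup_{\alpha<\beta}M_\alpha$; (4) for all $\beta<\lambda$, $M_\beta$ is transitive, $M_\beta\cap\mathrm{OR}=\beta$ and $|M_\beta|\le|\beta|+\aleph_0$. Here $\mathrm{OR}$ is the class of ordinals. Write $M_\lambda:=\bigcup_{\beta<\lambda}M_\beta$. A nice filtration $\langle M_\beta\mid\beta<\kappa^+\rangle$ of $H_{\kappa^+}$ is eventually slow at $\kappa$ iff there is an infinite cardinal $\mu<\kappa$ such that $M_\theta=H_\theta$ for every cardinal $\theta$ with $\mu<\theta\le\kappa$.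 **Local club condensation.** Let $\eta<\zeta$ be ordinals. $\vec M=\langle M_\beta\mid\beta<\lambda\rangle$, with $\lambda\ge\zeta$ a limit ordinal, witnesses that $\mathsf{LCC}(\eta,\zeta)$ holds iff: (1) $\vec M$ is a nice filtration of $M_\lambda$; (2) $\langle M_\lambda,\in\rangle\models\mathsf{ZF}^-$ ($\mathsf{ZF}$ without power set); (3) for every ordinal $\alpha$ with $\eta<\alpha<\zeta$ and every sequence $\vec{\mathcal F}=\langle(F_n,k_n)\mid n\in\omega\rangle$ in $M_\lambda$ with $k_n\in\omega$ and $F_n\subseteq(M_\alpha)^{k_n}$ for all $n$, there is a sequence $\vec{\mathfrak B}=\langle\mathfrak B_\beta\mid\beta<|\alpha|\rangle$ in $M_\lambda$ such that: (a) each $\mathfrak B_\beta$ is of the form $\langle B_\beta,\in,\vec M\restriction(B_\beta\cap\mathrm{OR}),(F_n\cap(B_\beta)^{k_n})_{n\in\omega}\rangle$; (b) $\mathfrak B_\beta\prec\langle M_\alpha,\in,\vec M\restriction\alpha,(F_n)_{n\in\omega}\rangle$ for all $\beta<|\alpha|$; (c) $\beta\subseteq B_\beta$ and $|B_\beta|<|\alpha|$ for all $\beta<|\alpha|$; (d) for all $\beta<|\alpha|$ there is $\bar\beta<\lambda$ such that the Mostowski collapse of $\langle B_\beta,\in,\langle M_\delta\mid\delta\in B_\beta\cap\mathrm{OR}\rangle\rangle$ is $\langle M_{\bar\beta},\in,\vec M\restriction\bar\beta\rangle$; (e) $\langle B_\beta\mid\beta<|\alpha|\rangle$ is $\subseteq$-increasing,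 continuous and has union $M_\alpha$. A restriction of $\vec M$ occurring in a structure is treated as the binary predicate given by its graph. **Logic.** A $\Pi^1_2$-sentence $\phi$ is a formula of the form $\forall X\exists Y\varphi$, where $\varphi$ is a first-order sentence over a relational language having: a binary predicate symbol $\epsilon$; a predicate symbol $\mathbb X$ of (finite) arity $m(\mathbb X)$; a predicate symbol $\mathbb Y$ of arity $m(\mathbb Y)$; and infinitely many predicate symbols $(\mathbb A_n)_{n\in\omega}$, each $\mathbb A_n$ of arity $m(\mathbb A_n)$. A set $N$ sees a set $x$ iff $N$ is transitive, p.r.-closed (closed under primitive recursive set functions), and $x\cup\{x\}\subseteq N$. Suppose $N$ sees an ordinal $\alpha$, $\phi=\forall X\exists Y\varphi$ is a $\Pi^1_2$-sentence and $A_n\subseteq\alpha^{m(\mathbb A_n)}$ for all $n\in\omega$. Then $\langle\alpha,\in,(A_n)_{n\in\omega}\rangle\models_N\phi$ means that: (1) $(A_n)_{n\in\omega}\in N$; and (2) $\langle N,\in\rangle\models(\forall X\subseteq\alpha^{m(\mathbb X)})(\exists Y\subseteq\alpha^{m(\mathbb Y)})[\langle\alpha,\in,X,Y,(A_n)_{n\in\omega}\rangle\models\varphi]$, where $\in,X,Y,A_n$ interpret $\epsilon,\mathbb X,\mathbb Y,\mathbb A_n$, respectively. For an ordinal $\alpha$, $\alpha^+$ denotes $|\alpha|^+$, and $\langle\alpha,\in,(A_n)_{n\in\omega}\rangle\models\phi$ abbreviates $\langle\alpha,\in,(A_n)_{n\in\omega}\rangle\models_{H_{\alpha^+}}\phi$.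 **The principle.** For $\kappa$ regular uncountable and $S\subseteq\kappa$ stationary, $\mathrm{Dl}^*_S(\Pi^1_2)$ asserts the existence of a sequence $\langle N_\alpha\mid\alpha\in S\rangle$ such that: (1) for every $\alpha\in S$, $N_\alpha$ is a set of cardinality $<\kappa$ that sees $\alpha$; (2) for every $X\subseteq\kappa$, there is a club $C\subseteq\kappa$ such that $X\cap\alpha\in N_\alpha$ for all $\alpha\in C\cap S$; (3) whenever $\langle\kappa,\in,(A_n)_{n\in\omega}\rangle\models\phi$, with $\phi$ a $\Pi^1_2$-sentence, there are stationarily many $\alpha\in S$ such that $|N_\alpha|=|\alpha|$ and $\langle\alpha,\in,(A_n\cap(\alpha^{m(\mathbb A_n)}))_{n\in\omega}\rangle\models_{N_\alpha}\phi$. *)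

(* Defs.v *)
From HB Require Import structures.
From mathcomp Require Import all_boot all_classical.
From mathcomp Require Import wochoice.

Set Implicit Arguments.
Unset Strict Implicit.
Unset Printing Implicit Defensive.

Local Open Scope classical_set_scope.
Local Open Scope card_scope.

(** * The universe of sets

    [V] is Aczel's type of well-founded trees modulo bisimulation.  Equality in [V] is Leibniz equality, and
    all axioms of ZFC hold in [V], Separation and Replacement even for
    arbitrary predicates and functions of Rocq.  Hence "class" means
    [set V], and a sequence indexed by a set is a function [V -> V] of which
    only the values on the index set matter; [vfun] turns it into an element
    of [V] where the sequence itself has to be an element of some set. *)

Inductive tree : Type := Node (A : Type) (f : A -> tree).

Fixpoint teq (s t : tree) : Prop :=
  match s, t with
  | Node A f, Node B g =>
      (forall i, exists j, teq (f i) (g j)) /\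
      (forall j, exists i, teq (f i) (g j))
  end.

Lemma teq_refl t : teq t t.
Proof. by elim: t => A f IH /=; split=> i; exists i. Qed.

Lemma teq_sym s t : teq s t -> teq t s.
Proof.
elim: s t => A f IH [B g] /= [H1 H2]; split=> [j|i].
  by have [i Hi] := H2 j; exists i; apply: IH.
by have [j Hj] := H1 i; exists j; apply: IH.
Qed.

Lemma teq_trans s t u : teq s t -> teq t u -> teq s u.
Proof.
elim: s t u => A f IH [B g] [C h] /= [H1 H2] [H3 H4]; split=> [i|k].
  have [j Hj] := H1 i; have [k Hk] := H3 j.
  by exists k; apply: IH Hj Hk.
have [j Hj] := H4 k; have [i Hi] := H2 j.
by exists i; apply: IH Hi Hj.
Qed.

Definition V : Type := {P : set tree | exists t, P = teq t}.

Definition cls (t : tree) : V := exist _ (teq t) (ex_intro _ t erefl).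
Definition rep (x : V) : tree := projT1 (cid (proj2_sig x)).

Lemma V_eq (x y : V) : sval x = sval y -> x = y.
Proof. by apply: eq_sig_hprop => ? ? ?; exact: Prop_irrelevance. Qed.

Lemma repK x : cls (rep x) = x.
Proof. by apply: V_eq; rewrite /rep; case: cid => t /= ->. Qed.

Lemma cls_eq s t : cls s = cls t <-> teq s t.
Proof.
split=> [/(congr1 (fun x : V => sval x t)) /= ->|st]; first exact: teq_refl.
apply: V_eq; apply/funext => u; apply/propext; split=> H.
  exact: teq_trans (teq_sym st) H.
exact: teq_trans st H.
Qed.

Definition idx (x : V) : Type := let: Node A _ := rep x in A.
Definition elt (x : V) : idx x -> V :=
  (let: Node A f as t := rep x return (let: Node A _ := t in A) -> V
   in fun i => cls (f i)).

Definition elts (x : V) : set V := range (elt (x := x)).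
Coercion elts : V >-> set.

Notation "x ∈ y" := (elts y x) (at level 70, no associativity).

(** The set of all [f i]. *)
Definition vsup (I : Type) (f : I -> V) : V := cls (Node (rep \o f)).

Lemma in_cls I (f : I -> tree) x : x ∈ cls (Node f) <-> exists i, x = cls (f i).
Proof.
have /cls_eq := repK (cls (Node f)).
rewrite /elts /elt /idx; case: (rep _) => B g /= [H1 H2].
split=> [[j _ <-]|[i ->]].
  by have [i Hi] := H1 j; exists i; apply/cls_eq.
by have [j Hj] := H2 i; exists j => //; apply/cls_eq.
Qed.

Lemma in_vsup I (f : I -> V) x : x ∈ vsup f <-> exists i, x = f i.
Proof.
rewrite in_cls; split=> -[i ->]; exists i; rewrite /= ?repK //.
Qed.

Lemma V_ext (x y : V) : (forall z, z ∈ x <-> z ∈ y) -> x = y.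
Proof.
rewrite -(repK x) -(repK y); case: (rep x) => A f; case: (rep y) => B g H.
apply/cls_eq; split=> [i|j].
  have /H/in_cls[j /cls_eq ?] : cls (f i) ∈ cls (Node f) by apply/in_cls; exists i.
  by exists j.
have /H/in_cls[i /cls_eq/teq_sym ?] : cls (g j) ∈ cls (Node g).
  by apply/in_cls; exists j.
by exists i.
Qed.

Lemma V_ind (P : V -> Prop) :
  (forall x : V, (forall y, y ∈ x -> P y) -> P x) -> forall x, P x.
Proof.
move=> H x; rewrite -(repK x); elim: (rep x) => A f IH.
by apply: H => y /in_cls[i ->].
Qed.

(** ** Elementary set formation *)

Definition vempty : V := vsup (fun e : False => match e with end).
Definition vsep (x : V) (P : V -> Prop) : V :=
  vsup (fun i : {i : idx x | P (elt i)} => elt (sval i)).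
Definition vimg (f : V -> V) (x : V) : V := vsup (fun i : idx x => f (elt i)).
Definition vpair (x y : V) : V := vsup (fun b : bool => if b then x else y).
Definition vUnion (x : V) : V :=
  vsup (fun p : {i : idx x & idx (elt i)} => elt (projT2 p)).
Definition vU (x y : V) : V := vUnion (vpair x y).
Definition vpow (x : V) : V :=
  vsup (fun P : idx x -> Prop => vsup (fun i : {i : idx x | P i} => elt (sval i))).
Definition vI (x y : V) : V := vsep x (elts y).
Definition vsucc (x : V) : V := vU x (vpair x x).

Lemma in_vempty x : ~ x ∈ vempty.
Proof. by case/in_vsup. Qed.

Lemma in_vsep x P z : z ∈ vsep x P <-> z ∈ x /\ P z.
Proof.
rewrite in_vsup; split=> [[[i Pi] ->]|[[i _ <-] Pi]]; last by exists (exist _ i Pi).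
by split=> //; exists i.
Qed.

Lemma in_vimg f x z : z ∈ vimg f x <-> exists2 y, y ∈ x & z = f y.
Proof.
rewrite in_vsup; split=> [[i ->]|[y [i _ <-] ->]]; last by exists i.
by exists (elt i) => //; exists i.
Qed.

Lemma in_vpair x y z : z ∈ vpair x y <-> z = x \/ z = y.
Proof.
rewrite in_vsup; split=> [[[] ->]|[->|->]]; [by left|by right| |].
  by exists true.
by exists false.
Qed.

Lemma in_vUnion x z : z ∈ vUnion x <-> exists2 y, y ∈ x & z ∈ y.
Proof.
rewrite in_vsup; split=> [[[i j] ->]|[y [i _ <-] [j _ <-]]].
  by exists (elt i); [exists i|exists j].
by exists (existT _ i j).
Qed.

Lemma in_vU x y z : z ∈ vU x y <-> z ∈ x \/ z ∈ y.
Proof.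
rewrite in_vUnion; split=> [[t /in_vpair[]-> ?]|[?|?]]; [by left|by right| |].
  by exists x => //; apply/in_vpair; left.
by exists y => //; apply/in_vpair; right.
Qed.

Lemma in_vpow x z : z ∈ vpow x <-> z `<=` x.
Proof.
rewrite in_vsup; split=> [[P ->] t /in_vsup[[i Pi] ->]|zx]; first by exists i.
exists (fun i => elt i ∈ z); apply: V_ext => t; rewrite in_vsup; split=> [tz|].
  by case: (zx _ tz) => i _ it; rewrite -it in tz *; exists (exist _ i tz).
by case=> -[i Pi] ->.
Qed.

Lemma in_vI x y z : z ∈ vI x y <-> z ∈ x /\ z ∈ y.
Proof. exact: in_vsep. Qed.

Lemma in_vsucc x z : z ∈ vsucc x <-> z ∈ x \/ z = x.
Proof. by rewrite in_vU in_vpair; split; [case=> [?|[?|?]]|case]; auto. Qed.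

HB.instance Definition _ := gen_eqMixin V.
HB.instance Definition _ := gen_choiceMixin V.
HB.instance Definition _ := isPointed.Build V vempty.

(** ** Pairs, finite tuples, set functions *)

Definition opair (x y : V) : V := vpair (vpair x x) (vpair x y).

(** Iterated Kuratowski pairs; a 1-tuple is its only component, so that
    [vexp A 1 = A]. *)
Definition ntuple (s : seq V) : V :=
  if s is x :: s' then foldl opair x s' else vempty.

Definition vprod (x y : V) : V :=
  vsup (fun p : idx x * idx y => opair (elt p.1) (elt p.2)).

(** [A ^ k], see [in_vexp]. *)
Definition vexp (A : V) (k : nat) : V :=
  if k is j.+1 then iter j (fun B => vprod B A) A else vpair vempty vempty.

Lemma in_vprod x y z :
  z ∈ vprod x y <-> exists u v, [/\ u ∈ x, v ∈ y & z = opair u v].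
Proof.
rewrite in_vsup; split=> [[[i j] ->]|[u [v [[i _ <-] [j _ <-] ->]]]].
  by exists (elt i), (elt j); split=> //; [exists i|exists j].
by exists (i, j).
Qed.

Lemma in_vexp (A : V) k z :
  z ∈ vexp A k <->
  exists s : seq V, [/\ size s = k, {in s, forall x, x ∈ A} & z = ntuple s].
Proof.
case: k => [|k] /=.
  rewrite in_vpair; split=> [|[s [/size0nil -> _ ->]]]; last by left.
  by move=> zE; exists [::]; split=> //; case: zE.
elim: k z => [|k IH] z /=.
  split=> [zA|[[|x [|y s]] [//= _ sA ->]]]; last by apply: sA; rewrite inE.
  by exists [:: z]; split=> // x; rewrite inE => /eqP ->.
rewrite in_vprod; split=> [[u [v [/IH[s [sk sA ->]] vA ->]]]|].
  exists (rcons s v); split; first by rewrite size_rcons sk.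
    by move=> x; rewrite mem_rcons inE => /orP[/eqP ->|/sA].
  by case: s sk {sA} => //= x s _; rewrite -cats1 foldl_cat.
case=> s; case/lastP: s => [|s v] [] //.
rewrite size_rcons => -[sk] sA ->.
exists (ntuple s), v; split.
- by apply/IH; exists s; split=> // x xs; apply: sA; rewrite mem_rcons inE xs orbT.
- by apply: sA; rewrite mem_rcons inE eqxx.
by case: s sk {sA} => //= x s _; rewrite -cats1 foldl_cat.
Qed.

(** The graph of [f] on the domain [a]. *)
Definition vfun (a : V) (f : V -> V) : V := vimg (fun x => opair x (f x)) a.

Fixpoint vnat (n : nat) : V := if n is m.+1 then vsucc (vnat m) else vempty.
Definition omega : V := vsup vnat.

(** The sequence [f] as a set function with domain [omega]. *)
Definition vseq (f : nat -> V) : V := vsup (fun n => opair (vnat n) (f n)).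

(** ** Ordinals and cardinals *)

Definition transitive_set (D : set V) : Prop := forall x, D x -> x `<=` D.

Definition strict_well_order (D : set V) (R : V -> V -> Prop) : Prop :=
  [/\ forall x, D x -> ~ R x x,
      forall x y z, D x -> D y -> D z -> R x y -> R y z -> R x z,
      forall x y, D x -> D y -> [\/ x = y, R x y | R y x]
    & forall A : set V, A `<=` D -> A !=set0 ->
        exists2 m, A m & forall x, A x -> x = m \/ R m x].

Definition ordinal (x : V) : Prop :=
  transitive_set x /\ strict_well_order x (fun y z => y ∈ z).

(** With this convention 0 is a limit ordinal. *)
Definition limit_ordinal (x : V) : Prop :=
  ordinal x /\ forall y, y ∈ x -> vsucc y ∈ x.

Definition card_lt (A B : set V) : Prop := (A #<= B) /\ ~ (B #<= A).
Notation "A '#<' B" := (card_lt A B) (at level 79) : card_scope.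

Definition cardinal (c : V) : Prop :=
  ordinal c /\ forall b, b ∈ c -> ~ (b #= c).
Definition infinite_cardinal (c : V) : Prop := cardinal c /\ omega `<=` c.

Definition is_card (x c : V) : Prop := cardinal c /\ (c #= x).
Definition is_card_succ (x c : V) : Prop :=
  [/\ cardinal c, (x #< c) & forall d, d ∈ c -> cardinal d -> ~ (x #< d)].

(** [|x|] and [|x|^+]: [xget] picks the unique witness, which exists by
    [vcardP] and [vcard_succP] below. *)
Definition vcard (x : V) : V := xget vempty (is_card x).
Definition vcard_succ (x : V) : V := xget vempty (is_card_succ x).

Lemma mem_irr x : ~ x ∈ x.
Proof. by elim/V_ind: x => x IH xx; apply: (IH x). Qed.

Lemma mem_asym x y : x ∈ y -> ~ y ∈ x.
Proof. by elim/V_ind: x y => x IH y xy yx; apply: (IH y yx x yx). Qed.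

Lemma V_min (D : set V) : D !=set0 -> exists2 m, D m & forall x, D x -> ~ x ∈ m.
Proof.
case=> x; elim/V_ind: x => x IH Dx.
have [[y Dy yx]|H] := pselect (exists2 y, D y & y ∈ x); first exact: IH yx Dy.
by exists x => // y Dy yx; apply: H; exists y.
Qed.

Lemma ordinal_in (x y : V) : ordinal x -> y ∈ x -> ordinal y.
Proof.
case=> tx [ix sx cx wx] yx; have yx' := tx _ yx; split.
  move=> z zy w wz; apply: (sx w z y) => //; last exact: yx'.
  exact: tx (yx' _ zy) _ wz.
split.
- by move=> z /yx'/ix.
- by move=> z w t /yx' zx /yx' wx' /yx' ttx; apply: sx.
- by move=> z w /yx' zx /yx' wx'; apply: cx.
- by move=> A Ay; apply: wx => z /Ay /yx'.
Qed.

Lemma ordinal_initial (x t : V) :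
  ordinal x -> transitive_set t -> t `<=` x -> t <> x -> t ∈ x.
Proof.
move=> [tx [ix sx cx wx]] tt tsx tNx.
have [m [mx mt] mmin] : exists2 m, m ∈ x /\ ~ m ∈ t &
    forall z, z ∈ x /\ ~ z ∈ t -> z = m \/ m ∈ z.
  apply: (wx (fun m => m ∈ x /\ ~ m ∈ t)) => [z []//|].
  apply: contrapT => H; apply: tNx; apply: V_ext => z; split=> [/tsx//|zx].
  by apply: contrapT => zt; apply: H; exists z.
suff -> : t = m by [].
apply: V_ext => z; split=> [zt|zm].
  case: (cx z m (tsx _ zt) mx) => // [zm|mz]; first by rewrite zm in zt.
  by case: mt; apply: tt mz.
apply: contrapT => zt; case: (mmin z); first by split=> //; apply: tx zm.
  by move=> zE; rewrite zE in zm; apply: mem_irr zm.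
exact: mem_asym.
Qed.

Lemma ordinal_total x y : ordinal x -> ordinal y -> [\/ x = y, x ∈ y | y ∈ x].
Proof.
move=> ox oy; pose z := vI x y.
have tz : transitive_set z.
  move=> u /in_vI[ux uy] w wu; apply/in_vI.
  by split; [apply: ox.1 wu|apply: oy.1 wu].
have [zx|zx] := pselect (z = x); have [zy|zy] := pselect (z = y).
- by constructor 1; rewrite -zx.
- constructor 2; rewrite -zx; apply: ordinal_initial => // u /in_vI[]//.
- constructor 3; rewrite -zy; apply: ordinal_initial => // u /in_vI[]//.
have ? : z ∈ x by apply: ordinal_initial => // u /in_vI[].
have ? : z ∈ y by apply: ordinal_initial => // u /in_vI[].
by exfalso; apply: (@mem_irr z); apply/in_vI.
Qed.

Lemma ordinal_card (x : V) : exists2 a, ordinal a & (a #= x).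
Proof.
have [R woR] := well_ordering_principle V.
pose lt a b := R a b /\ a <> b.
have minR (A : set V) : A !=set0 -> exists2 m, A m & forall z, A z -> z = m \/ lt m z.
  case=> y Ay; have [|m [[mA mP] _]] := woR [pred z | `[< A z >]].
    by exists y; apply/asboolP.
  exists m; first exact/asboolP.
  move=> z Az; have [|/eqP mz] := eqVneq z m; [by left|right; split=> [|/esym//]].
  by apply: mP; apply/asboolP.
have antiR a b : R a b -> R b a -> a = b.
  move=> ab ba; have [|m [_ mU]] := woR [pred z | (z == a) || (z == b)].
    by exists a; apply/orP; left.
  have rx c : R c c.
    have [|n [[nA nP] _]] := woR [pred z | z == c]; first by exists c; apply/eqP.
    by have := nP c; move/eqP: nA => ->; apply; apply/eqP.
  have mE c : c = a \/ c = b -> m = c.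
    move=> cab; apply: mU; split; first by apply/orP; case: cab => ->; [left|right].
    by move=> z /orP[] /eqP ->; case: cab => ->.
  by rewrite -(mE a) ?(mE b); auto.
have lt_irr a : ~ lt a a by case.
have lt_tot a b : [\/ a = b, lt a b | lt b a].
  have [|m mab mP] := minR (fun z => z = a \/ z = b); first by exists a; left.
  have [ma|mb] := mab; subst m.
    by case: (mP b) => [|->|]; [right|constructor 1|constructor 2].
  by case: (mP a) => [|->|]; [left|constructor 1|constructor 3].
have lt_asym a b : lt a b -> ~ lt b a.
  by move=> [ab abN] [ba _]; apply: abN; apply: antiR.
have lt_wf : well_founded lt.
  move=> a; apply: contrapT => Na.
  have [|m Nm mP] := minR (fun z => ~ Acc lt z); first by exists a.
  apply: Nm; constructor => z zm; apply: contrapT => /mP[zE|/lt_asym//].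
  by apply: (lt_irr m); rewrite {1}zE in zm.
have lt_trans a b c : lt a b -> lt b c -> lt a c.
  move=> ab bc; have [|m mabc mP] := minR (fun z => [\/ z = a, z = b | z = c]).
    by exists a; constructor 1.
  case: mabc => mE; subst m.
  - case: (mP c) => [|cE|//]; first by constructor 3.
    by rewrite cE in bc; case: (lt_asym _ _ ab).
  - case: (mP a) => [|aE|/lt_asym//]; first by constructor 1.
    by rewrite aE in ab; case: (lt_irr b).
  - case: (mP b) => [|bE|/lt_asym//]; first by constructor 2.
    by rewrite bE in bc; case: (lt_irr c).
pose step b (rec : forall a, lt a b -> V) : V :=
  vsup (fun i : {i : idx x | lt (elt i) b} => rec (elt (sval i)) (svalP i)).
pose g := Fix lt_wf (fun _ => V) step.
have gE b z : z ∈ g b <-> exists a, [/\ a ∈ x, lt a b & z = g a].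
  rewrite /g Fix_eq; last first.
    by move=> c f f' ff'; congr vsup; apply/funext => i; apply: ff'.
  rewrite in_vsup; split=> [[[i ib] ->]|[a [[i _ <-] ab ->]]].
    by exists (elt i); split=> //; exists i.
  by exists (exist _ i ab).
have g_mono a b : a ∈ x -> lt a b -> g a ∈ g b by move=> ? ?; apply/gE; exists a.
have g_inj a b : a ∈ x -> b ∈ x -> g a = g b -> a = b.
  move=> ax bx gab; case: (lt_tot a b) => // /g_mono; rewrite gab => H;
  by case: (@mem_irr (g b)); apply: H.
have gP a b : a ∈ x -> b ∈ x -> g a ∈ g b -> lt a b.
  by move=> ax bx /gE[c [cx cb /g_inj ->]].
exists (vimg g x); last first.
  rewrite card_eq_sym; apply/card_set_bijP; exists g; split.
  - by move=> a ax; apply/in_vimg; exists a.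
  - by move=> a b /set_mem ax /set_mem bx; apply: g_inj.
  - by move=> z /in_vimg[a ax ->]; exists a.
split.
  move=> z /in_vimg[b bx ->] w /gE[a [ax _ ->]].
  by apply/in_vimg; exists a.
split.
- by move=> z _; apply: mem_irr.
- move=> ? ? ? /in_vimg[a ax ->] /in_vimg[b bx ->] /in_vimg[c cx ->].
  by move=> /gP ab /gP bc; apply: g_mono => //; apply: (lt_trans a b c); auto.
- move=> ? ? /in_vimg[a ax ->] /in_vimg[b bx ->].
  case: (lt_tot a b) => [->|ab|ba]; first by constructor 1.
    by constructor 2; apply: g_mono.
  by constructor 3; apply: g_mono.
- move=> A AD [z Az]; have /in_vimg[a ax zE] := AD _ Az.
  have [|m [mx Am] mP] := minR (fun a => a ∈ x /\ A (g a)).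
    by exists a; split=> //; rewrite -zE.
  exists (g m) => // w Aw; have /in_vimg[b bx wE] := AD _ Aw; subst w.
  by case: (mP b) => // [->|mb]; [left|right; apply: g_mono].
Qed.

Lemma vcard_ex x : exists c, is_card x c.
Proof.
have [a oa ax] := ordinal_card x.
have [|c [oc cx] cmin] := @V_min (fun a => ordinal a /\ a #= x); first by exists a.
exists c; split=> //; split=> // b bc b_c; apply: (cmin b) => //.
by split; [apply: ordinal_in bc|apply: card_eq_trans cx].
Qed.

Lemma vcardP x : is_card x (vcard x).
Proof. by have [c ?] := vcard_ex x; apply: xgetPex; exists c. Qed.

Lemma is_card_uniq x c d : is_card x c -> is_card x d -> c = d.
Proof.
move=> [[oc cmin] cx] [[od dmin] dx].
have cd : c #= d by apply: card_eq_trans cx _; rewrite card_eq_sym.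
case: (ordinal_total oc od) => // [/dmin[]//|/cmin[]].
by rewrite card_eq_sym.
Qed.

Lemma card_lt_vpow (x : V) : x #< vpow x.
Proof.
split.
  apply/pcard_leP; apply/injfunPex; exists (fun a => vpair a a).
    by move=> a ax; apply/in_vpow => z /in_vpair[]->.
  move=> a b _ _ ab; have : a ∈ vpair b b by rewrite -ab; apply/in_vpair; left.
  by case/in_vpair.
move/pcard_leP/injfunPex => [f fx finj].
pose d := vsep x (fun a => exists2 y : V, y `<=` x & a = f y /\ ~ a ∈ y).
have dx : d `<=` x by move=> z /in_vsep[].
have fd : f d ∈ x by apply: fx; apply/in_vpow.
have Nd : ~ f d ∈ d.
  move=> H; have /in_vsep[_ [y yx [fdy]]] := H; case.
  suff <- : d = y by [].
  by apply: finj fdy; rewrite inE; apply/in_vpow.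
by apply: (Nd); apply/in_vsep; split=> //; exists d.
Qed.

Lemma vcard_succ_ex x : exists c, is_card_succ x c.
Proof.
have [cc cx] := vcardP (vpow x).
have [xp px] := card_lt_vpow x.
have [|c [cc' xc] cmin] := @V_min (fun c => cardinal c /\ x #< c).
  exists (vcard (vpow x)); split=> //; case/card_eqPle: cx => cp pc; split.
    exact: card_le_trans xp pc.
  by move=> H; apply: px; apply: card_le_trans pc H.
by exists c; split=> // d dc cd xd; apply: (cmin d).
Qed.

Lemma vcard_succP x : is_card_succ x (vcard_succ x).
Proof. by have [c ?] := vcard_succ_ex x; apply: xgetPex; exists c. Qed.

Lemma is_card_succ_uniq x c d : is_card_succ x c -> is_card_succ x d -> c = d.
Proof.
move=> [cc xc cmin] [cd xd dmin].
case: (ordinal_total cc.1 cd.1) => // [/dmin/(_ cc xc)|/cmin/(_ cd xd)] //.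
Qed.

(** ** Clubs, stationary sets, regularity *)

Definition club (kappa C : V) : Prop :=
  [/\ C `<=` kappa,
      forall a, a ∈ kappa -> exists2 b, b ∈ C & a ∈ b
    & forall d, d ∈ kappa -> limit_ordinal d -> d <> vempty ->
        (forall a, a ∈ d -> exists b, [/\ b ∈ C, b ∈ d & a ∈ b]) -> d ∈ C].

Definition stationary (kappa S : V) : Prop :=
  S `<=` kappa /\ forall C, club kappa C -> exists2 a, a ∈ C & a ∈ S.

Definition regular_uncountable (kappa : V) : Prop :=
  [/\ cardinal kappa, omega ∈ kappa
    & forall (b : V) (f : V -> V), b ∈ kappa ->
        (forall x, x ∈ b -> f x ∈ kappa) ->
        exists2 c, c ∈ kappa & forall x, x ∈ b -> f x ∈ c].

(** ** Hereditary cardinality *)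

(** The least transitive superset of [x]. *)
Definition trcl (x : V) : set V :=
  [set y | forall T : set V, transitive_set T -> x `<=` T -> T y].

Definition Hset (theta : V) : set V := [set x | trcl x #< theta].

(** * First-order logic with equality over relational languages

    [fml L n] is the type of formulas with free variables among 0, ..., n-1
    and [fml L 0] that of sentences.  The variable bound by [All] has index 0
    in the scope of the quantifier. *)

Record language := Language { symbol : Type; arity : symbol -> nat }.

Inductive fml (L : language) (n : nat) : Type :=
| Eq (i j : 'I_n)
| Rel (r : symbol L) (v : (arity r).-tuple 'I_n)
| Bot
| Imp (f g : fml L n)
| All (f : fml L n.+1).

Record structure (L : language) := Structure {
  dom : set V;
  interp : forall r : symbol L, set ((arity r).-tuple V)
}.

Fixpoint sat (L : language) (A : structure L) (n : nat) (f : fml L n) :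
    n.-tuple V -> Prop :=
  match f with
  | Eq i j => fun e => tnth e i = tnth e j
  | Rel r v => fun e => interp A (map_tuple (tnth e) v)
  | Bot => fun=> False
  | Imp g h => fun e => sat A g e -> sat A h e
  | All g => fun e => forall x, dom A x -> sat A g [tuple of x :: e]
  end.

Definition elementary (L : language) (A B : structure L) : Prop :=
  dom A `<=` dom B /\
  forall n (f : fml L n) (e : n.-tuple V),
    (forall i, dom A (tnth e i)) -> (sat A f e <-> sat B f e).

(** The language of set theory and the structure [<D, ∈>]. *)
Definition set_language : language := Language (fun _ : unit => 2).
Definition set_structure (D : set V) : structure set_language :=
  @Structure set_language D (fun _ e => tnth e ord0 ∈ tnth e ord_max).

(** [<D, ∈>] is a model of ZF without the power set axiom. *)
Record ZF_minus (D : set V) : Prop := {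
  zf_extensionality : forall x y, D x -> D y ->
    (forall z, D z -> (z ∈ x <-> z ∈ y)) -> x = y;
  zf_foundation : forall x, D x -> (exists2 y, D y & y ∈ x) ->
    exists y, [/\ D y, y ∈ x & forall z, D z -> z ∈ x -> ~ z ∈ y];
  zf_pairing : forall x y, D x -> D y ->
    exists2 p, D p & forall z, D z -> (z ∈ p <-> z = x \/ z = y);
  zf_union : forall x, D x ->
    exists2 u, D u &
      forall z, D z -> (z ∈ u <-> exists y, [/\ D y, y ∈ x & z ∈ y]);
  zf_infinity : exists w, [/\ D w,
    exists e, [/\ D e, e ∈ w & forall z, D z -> ~ z ∈ e]
    & forall y, D y -> y ∈ w -> exists s, [/\ D s, s ∈ w &
        forall z, D z -> (z ∈ s <-> z ∈ y \/ z = y)]];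
  zf_separation : forall n (f : fml set_language n.+1) (p : n.-tuple V) a,
    (forall i, D (tnth p i)) -> D a ->
    exists2 b, D b & forall x, D x ->
      (x ∈ b <-> x ∈ a /\ sat (set_structure D) f [tuple of x :: p]);
  zf_replacement : forall n (f : fml set_language n.+2) (p : n.-tuple V) a,
    let F x y := sat (set_structure D) f [tuple of x :: y :: p] in
    (forall i, D (tnth p i)) -> D a ->
    (forall x y z, D x -> D y -> D z -> x ∈ a -> F x y -> F x z -> y = z) ->
    exists2 b, D b & forall y, D y ->
      (y ∈ b <-> exists x, [/\ D x, x ∈ a & F x y])
}.

(** * Filtrations *)

Definition filtration_union (lambda : V) (M : V -> V) : set V :=
  [set x | exists2 b, b ∈ lambda & x ∈ M b].

Definition nice_filtration (lambda : V) (M : V -> V) (N : set V) : Prop :=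
  [/\ transitive_set N /\ limit_ordinal lambda,
      filtration_union lambda M = N,
      forall a b, a ∈ b -> b ∈ lambda -> M a ∈ M b,
      forall b, b ∈ lambda -> limit_ordinal b -> b <> vempty ->
        M b = filtration_union b M :> set V
    & forall b, b ∈ lambda ->
        [/\ transitive_set (M b),
            forall x, (x ∈ M b /\ ordinal x) <-> x ∈ b
          & M b #<= (inl @` b `|` inr @` omega : set (V + V))]].

Definition eventually_slow (kappa : V) (M : V -> V) : Prop :=
  exists mu, [/\ infinite_cardinal mu, mu ∈ kappa
    & forall theta, cardinal theta -> mu ∈ theta ->
        theta ∈ kappa \/ theta = kappa -> M theta = Hset theta :> set V].

(** * Local club condensation *)

Inductive lcc_symbol := lcc_mem | lcc_filt | lcc_pred of nat.

Definition lcc_language (k : nat -> nat) : language :=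
  Language (fun r => match r with
                     | lcc_mem => 2
                     | lcc_filt => 2
                     | lcc_pred n => k n
                     end).

(** The structure [<B, ∈, G, (F n)_n>], where the set [G] of pairs is the
    graph of a sequence, and its code as a set. *)
Definition lcc_structure k (B G : V) (F : nat -> V) :
    structure (lcc_language k) :=
  @Structure (lcc_language k) B (fun r =>
    match r return set ((arity (l := lcc_language k) r).-tuple V) with
    | lcc_mem => fun e => tnth e ord0 ∈ tnth e ord_max
    | lcc_filt => fun e => ntuple e ∈ G
    | lcc_pred n => fun e => ntuple e ∈ F n
    end).

Definition mem_graph (B : V) : V :=
  vsep (vprod B B) (fun p => exists x y, p = opair x y /\ x ∈ y).

Definition lcc_code (B G : V) (F : nat -> V) : V :=
  ntuple [:: B; mem_graph B; G; vseq F].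

(** [pi] is the Mostowski collapsing function on [B]. *)
Definition mostowski (B : V) (pi : V -> V) : Prop :=
  forall x, x ∈ B -> pi x = vimg pi (vI x B).

(** The Mostowski collapse of [<B, ∈, G>] is [<B', ∈, G'>], for sets of pairs
    [G] and [G'] seen as binary predicates. *)
Definition collapses_to (B G B' G' : V) : Prop :=
  exists pi, [/\ mostowski B pi,
    vimg pi B = B'
    & [set z | exists x y, [/\ x ∈ B, y ∈ B, opair x y ∈ G
                             & z = opair (pi x) (pi y)]] = G' :> set V].

Definition ordinals_in (B : V) : V := vsep B ordinal.

(** [M = <M_b | b < lambda>] witnesses that LCC(eta, zeta) holds. *)
Definition witnesses_LCC (eta zeta lambda : V) (M : V -> V) : Prop :=
  [/\ [/\ ordinal zeta, eta ∈ zeta, limit_ordinal lambda & zeta `<=` lambda],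
      nice_filtration lambda M (filtration_union lambda M),
      ZF_minus (filtration_union lambda M)
    & forall (alpha : V) (F : nat -> V) (k : nat -> nat),
        eta ∈ alpha -> alpha ∈ zeta ->
        filtration_union lambda M (vseq (fun n => opair (F n) (vnat (k n)))) ->
        (forall n, F n `<=` vexp (M alpha) (k n)) ->
        exists B : V -> V,
        let G b := vfun (ordinals_in (B b)) M in
        let FB b n := vI (F n) (vexp (B b) (k n)) in
        [/\ filtration_union lambda M
              (vfun (vcard alpha) (fun b => lcc_code (B b) (G b) (FB b))),
            forall b, b ∈ vcard alpha ->
              elementary (lcc_structure k (B b) (G b) (FB b))
                         (lcc_structure k (M alpha) (vfun alpha M) F),
            forall b, b ∈ vcard alpha -> b `<=` B b /\ (B b #< alpha),
            forall b, b ∈ vcard alpha ->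
              exists2 b', b' ∈ lambda &
                collapses_to (B b) (G b) (M b') (vfun b' M)
          & [/\ forall b c, b ∈ c -> c ∈ vcard alpha -> B b `<=` B c,
                forall b, b ∈ vcard alpha -> limit_ordinal b -> b <> vempty ->
                  B b = filtration_union b B :> set V
              & filtration_union (vcard alpha) B = M alpha]]].

(** * Primitive recursive set functions (Jensen and Karp) *)

(** The initial functions [x ∪ {y}] and [if u ∈ v then x else y] are
    precomposed with primitive recursive functions. *)
Inductive pr_function : forall n : nat, (n.-tuple V -> V) -> Prop :=
| pr_proj n (i : 'I_n) : pr_function (fun x : n.-tuple V => tnth x i)
| pr_empty n : pr_function (fun _ : n.-tuple V => vempty)
| pr_adjoin n (F G : n.-tuple V -> V) :
    pr_function F -> pr_function G ->
    pr_function (fun x => vU (F x) (vpair (G x) (G x)))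
| pr_if n (F G P Q : n.-tuple V -> V) :
    pr_function F -> pr_function G -> pr_function P -> pr_function Q ->
    pr_function (fun x => if `[< P x ∈ Q x >] then F x else G x)
| pr_comp m n (G : m.-tuple V -> V) (F : 'I_m -> n.-tuple V -> V) :
    pr_function G -> (forall i, pr_function (F i)) ->
    pr_function (fun x => G [tuple F i x | i < m])
| pr_rec n (G : n.+2.-tuple V -> V) (F : n.+1.-tuple V -> V) :
    pr_function G ->
    (forall z (x : n.-tuple V), F [tuple of z :: x] =
      G [tuple of vUnion (vimg (fun u => F [tuple of u :: x]) z) :: z :: x]) ->
    pr_function F.

Definition pr_closed (N : set V) : Prop :=
  forall n (F : n.-tuple V -> V), pr_function F ->
    forall x : n.-tuple V, (forall i, N (tnth x i)) -> N (F x).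

Definition sees (N : set V) (x : V) : Prop :=
  [/\ transitive_set N, pr_closed N, N x & x `<=` N].

(** * Pi^1_2 sentences *)

Inductive pi12_symbol := pi12_mem | pi12_X | pi12_Y | pi12_A of nat.

Definition pi12_language (mX mY : nat) (mA : nat -> nat) : language :=
  Language (fun r => match r with
                     | pi12_mem => 2
                     | pi12_X => mX
                     | pi12_Y => mY
                     | pi12_A n => mA n
                     end).

(** The sentence [∀X ∃Y matrix], along with the arities of the symbols of its
    language. *)
Record pi12_sentence := Pi12 {
  mX : nat;
  mY : nat;
  mA : nat -> nat;
  matrix : fml (pi12_language mX mY mA) 0
}.

Definition pi12_structure mX mY mA (alpha X Y : V) (A : nat -> V) :
    structure (pi12_language mX mY mA) :=
  @Structure (pi12_language mX mY mA) alpha (fun r =>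
    match r return set ((arity (l := pi12_language mX mY mA) r).-tuple V) with
    | pi12_mem => fun e => tnth e ord0 ∈ tnth e ord_max
    | pi12_X => fun e => ntuple e ∈ X
    | pi12_Y => fun e => ntuple e ∈ Y
    | pi12_A n => fun e => ntuple e ∈ A n
    end).

(** [<alpha, ∈, (A n)_n> |=_N phi], for [N] that sees [alpha].  Such an [N] is
    transitive and closed under primitive recursive set functions, so that
    [X ⊆ alpha^m] and first-order satisfaction in a structure that belongs
    to [N] are absolute between [N] and [V]: evaluating the right-hand side
    in [<N, ∈>] amounts to letting [X] and [Y] range over [N]. *)
Definition pi12_models_in (N : set V) (alpha : V) (A : nat -> V)
    (phi : pi12_sentence) : Prop :=
  N (vseq A) /\
  forall X, N X -> X `<=` vexp alpha (mX phi) ->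
  exists Y, [/\ N Y, Y `<=` vexp alpha (mY phi)
    & sat (pi12_structure (mX phi) (mY phi) (mA phi) alpha X Y A)
          (matrix phi) [tuple]].

Definition pi12_models (alpha : V) (A : nat -> V) (phi : pi12_sentence) : Prop :=
  pi12_models_in (Hset (vcard_succ alpha)) alpha A phi.

(** * The principle Dl^*_S(Pi^1_2) *)

Definition Dl_star (kappa S : V) : Prop :=
  exists N : V -> V,
  [/\ forall alpha, alpha ∈ S -> (N alpha #< kappa) /\ sees (N alpha) alpha,
      forall X : V, X `<=` kappa ->
        exists2 C, club kappa C &
          forall alpha, alpha ∈ C -> alpha ∈ S -> vI X alpha ∈ N alpha
    & forall (phi : pi12_sentence) (A : nat -> V),
        (forall n, A n `<=` vexp kappa (mA phi n)) ->
        pi12_models kappa A phi ->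
        stationary kappa (vsep S (fun alpha => (N alpha #= alpha) /\
          pi12_models_in (N alpha) alpha
            (fun n => vI (A n) (vexp alpha (mA phi n))) phi))].

(* Main.v *)
Require Import Defs.
From mathcomp Require Import all_boot all_classical.
Import Defs.

(** For [alpha] in [S] put [N alpha = M f(alpha)], where by recursion [f(alpha)] is the least [xi] which is
    _bad_ for [alpha]: [M xi] sees [alpha], satisfies some Pi^1_2 sentence [phi(A)] at [alpha], and
    contains an unbounded subset [D] of [alpha] such that no limit point [delta] of [D] in [S ∩ alpha]
    has [N delta] of size [delta] and satisfying [phi(A ∩ delta)].  If there is no bad [xi < kappa], then
    [f(alpha)] is a bound for the heights of the collapsed hulls considered next.

    LCC yields, for [kappa < gamma < kappa^+] and club many [delta < kappa], an elementary
    substructure [B] of [M gamma] with [B ∩ kappa = delta] whose collapse is some [M delta'] of size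
    [|delta|].  Badness is absolute: if [gamma] is bad for [kappa], then [delta'] is bad for [delta], and
    if some [xi < delta'] is bad for [delta], then its preimage is bad for [kappa].  Hence no [gamma] is
    bad for [kappa]: if [gamma] were least, then [f(delta) = delta'] for some [delta] in [S] that is a
    limit point of the corresponding [D], so [N delta] reflects the corresponding [phi], a
    contradiction.  This is clause (3), as a failure of it is seen by some [M gamma].  It also gives
    [delta' <= f(delta)] for all hulls; if [X] is in [B], then [X ∩ delta] is in [M delta'], which gives
    clause (2).  That [M kappa = H kappa] provides cardinal arithmetic below [kappa^+] and the bound
    on the heights of the hulls. *)

Set Implicit Arguments.
Unset Strict Implicit.
Unset Printing Implicit Defensive.

Local Open Scope classical_set_scope.
Local Open Scope card_scope.

Local Notation code := (GenTree.tree nat).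

(** * Cardinals, ordinals and tuples *)

Lemma card_leI T (A : set T) (B : set V) (f : T -> V) :
  (forall x, A x -> B (f x)) ->
  (forall x y, A x -> A y -> f x = f y -> x = y) -> A #<= B.
Proof.
move=> fAB finj; apply/pcard_leP/injfunPex; exists f; first by move=> x /fAB.
by move=> x y /set_mem Ax /set_mem Ay; apply: finj.
Qed.

Lemma card_leE T (A : set T) (B : set V) : A #<= B ->
  exists2 f : T -> V, forall x, A x -> B (f x) &
    forall x y, A x -> A y -> f x = f y -> x = y.
Proof.
move=> /pcard_leP/injfunPex[f fAB finj]; exists f; first by move=> x /fAB.
by move=> x y Ax Ay; apply: finj; rewrite inE.
Qed.

Lemma card_le_surj T (A : set T) (B : set V) (f : V -> T) :
  (forall x, A x -> exists2 y, B y & x = f y) -> A #<= B.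
Proof.
move=> fBA; pose g x := xget vempty [set y | B y /\ x = f y].
have gP x : A x -> B (g x) /\ x = f (g x).
  by move=> /fBA[y By xE]; apply: (@xgetPex _ vempty [set y | B y /\ x = f y]); exists y.
apply: (@card_leI _ _ _ g) => [x /gP[]//|x y /gP[_ {2}->] /gP[_ {2}->] ->//].
Qed.

Lemma card_eqI T U (A : set T) (B : set U) : A #<= B -> B #<= A -> A #= B.
Proof. by move=> AB BA; apply/card_eqPle. Qed.

Lemma card_eq_leL T U (A : set T) (B : set U) : A #= B -> A #<= B.
Proof. by case/card_eqPle. Qed.

Lemma card_eq_leR T U (A : set T) (B : set U) : A #= B -> B #<= A.
Proof. by case/card_eqPle. Qed.

Lemma card_le_lt_trans (A B C : set V) : A #<= B -> B #< C -> A #< C.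
Proof.
move=> AB [BC CB]; split; first exact: card_le_trans BC.
by move=> CA; apply: CB; apply: card_le_trans CA AB.
Qed.

Lemma card_lt_le_trans (A B C : set V) : A #< B -> B #<= C -> A #< C.
Proof.
move=> [AB BA] BC; split; first exact: card_le_trans BC.
by move=> CA; apply: BA; apply: card_le_trans BC CA.
Qed.

Lemma ordinal_sub (a b : V) : ordinal a -> ordinal b ->
  a `<=` b <-> a ∈ b \/ a = b.
Proof.
move=> oa ob; split=> [ab|[/ob.1//|->//]].
have [->|aNb] := pselect (a = b); [by right|left].
exact: ordinal_initial oa.1 ab aNb.
Qed.

Lemma ordinal_notin (a b : V) : ordinal a -> ordinal b -> ~ a ∈ b -> b `<=` a.
Proof.
move=> oa ob ab; case: (ordinal_total oa ob) => [->//|//|].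
exact: oa.1.
Qed.

Lemma ordinal_sub_in (a b c : V) : ordinal a -> ordinal b -> ordinal c ->
  a `<=` b -> b ∈ c -> a ∈ c.
Proof. by move=> oa ob oc /(ordinal_sub oa ob)[ab|-> //] bc; apply: oc.1 ab. Qed.

Lemma ordinalI (x : V) : transitive_set x -> (forall y, y ∈ x -> ordinal y) ->
  ordinal x.
Proof.
move=> tx ox; split=> //; split.
- by move=> y _; apply: mem_irr.
- by move=> y z t _ _ /ox ot yz zt; apply: ot.1 yz.
- by move=> y z /ox oy /ox oz; apply: ordinal_total.
- move=> A Ax /V_min[m Am mmin]; exists m => // y Ay.
  case: (ordinal_total (ox _ (Ax _ Ay)) (ox _ (Ax _ Am))); [by left|by move/mmin|by right].
Qed.

Lemma ordinal_vUnion (x : V) : (forall y, y ∈ x -> ordinal y) -> ordinal (vUnion x).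
Proof.
move=> ox; apply: ordinalI => y /in_vUnion[z zx yz]; last first.
  exact: ordinal_in (ox _ zx) yz.
by move=> t ty; apply/in_vUnion; exists z => //; apply: (ox _ zx).1 ty.
Qed.

Lemma ordinal_vsucc x : ordinal x -> ordinal (vsucc x).
Proof.
move=> ox; apply: ordinalI => y /in_vsucc[yx|->//]; last 2 first.
- by move=> z zx; apply/in_vsucc; left.
- exact: ordinal_in yx.
by move=> z zy; apply/in_vsucc; left; apply: ox.1 zy.
Qed.

Lemma card_elem (b c : V) : cardinal c -> b ∈ c -> b #< c.
Proof.
move=> [oc cmin] bc; have bsub : b #<= c by apply: subset_card_le; apply: oc.1.
by split=> // cb; apply: (cmin b) => //; apply: card_eqI.
Qed.

Lemma card_lt_elem (b c : V) : cardinal c -> ordinal b -> b #< c -> b ∈ c.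
Proof.
move=> [oc _] ob [_ cb]; apply: contrapT => bc; apply: cb.
by apply: subset_card_le; apply: ordinal_notin.
Qed.

(** Replacement for classes: [A] is the image of a subset of [c] under the inverse of the
    injection. *)
Lemma set_of_card_le (A : set V) (c : V) : A #<= c -> exists x : V, x = A :> set V.
Proof.
move=> /card_leE[f fc finj].
pose g y := xget vempty [set x | A x /\ f x = y].
exists (vimg g (vsep c (fun y => exists2 x, A x & f x = y))).
apply/seteqP; split=> x /=.
  move=> /in_vimg[y /in_vsep[_ [z Az zy]] ->].
  by have [] := @xgetPex _ vempty [set x | A x /\ f x = y] (ex_intro _ z (conj Az zy)).
move=> Ax; apply/in_vimg; exists (f x).
  by apply/in_vsep; split; [apply: fc|exists x].
have [] := @xgetPex _ vempty [set z | A z /\ f z = f x] (ex_intro _ x (conj Ax erefl)).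
by rewrite -/(g (f x)) => Ag /finj ->.
Qed.

Lemma card_lt_ex (A : set V) (c : V) : cardinal c -> A #< c ->
  exists2 d, d ∈ c & d #= A.
Proof.
move=> cc Ac; have [x xA] := set_of_card_le Ac.1; rewrite -xA in Ac *.
have [[od _] dx] := vcardP x; exists (vcard x) => //.
by apply: card_lt_elem => //; apply: card_le_lt_trans Ac; apply: card_eq_leL.
Qed.

Lemma card_le_total (x y : V) : x #<= y \/ y #<= x.
Proof.
have [[od _] /card_eqPle[dx xd]] := vcardP x.
have [[oe _] /card_eqPle[ey ye]] := vcardP y.
have H (a b : V) : a `<=` b -> a #<= b by apply: subset_card_le.
case: (pselect (vcard x ∈ vcard y)) => [/oe.1/H de|/(ordinal_notin od oe)/H ed].
  by left; apply: card_le_trans xd _; apply: card_le_trans de ey.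
by right; apply: card_le_trans ye _; apply: card_le_trans ed dx.
Qed.

(** If [b] does not inject into [kappa], then its cardinality is a cardinal below the successor and
    larger than [kappa], against leastness. *)
Lemma in_vcard_succ (kappa b : V) : ordinal b ->
  b ∈ vcard_succ kappa <-> b #<= kappa.
Proof.
move=> ob; have [cs ks smin] := vcard_succP kappa; split=> [bs|bk]; last first.
  by apply: card_lt_elem => //; apply: card_le_lt_trans ks.
apply: contrapT => bk; have [[od dmin] db] := vcardP b.
have kb : kappa #<= b by case: (card_le_total b kappa).
have kd : kappa #< vcard b.
  split=> [|dk]; first by apply: card_le_trans kb (card_eq_leR db).
  by apply: bk; apply: card_le_trans dk; apply: card_eq_leR.
apply: (smin (vcard b)) => //; apply: card_lt_elem => //.
by apply: card_le_lt_trans (card_elem cs bs); apply: card_eq_leL.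
Qed.

Lemma card_lt_succ (A : set V) (kappa : V) :
  A #< vcard_succ kappa <-> A #<= kappa.
Proof.
have [cs ks smin] := vcard_succP kappa; split=> [As|Ak]; last first.
  exact: card_le_lt_trans ks.
have [d ds dA] := card_lt_ex cs As.
apply: card_le_trans (card_eq_leR dA) _.
by apply/in_vcard_succ => //; apply: ordinal_in cs.1 ds.
Qed.

Lemma trcl_transitive (x : V) : transitive_set (trcl x).
Proof. by move=> y xy z zy T tT xT; apply: (tT y) => //; apply: xy. Qed.

Lemma trcl_sub (x : V) : x `<=` trcl x.
Proof. by move=> y yx T tT; apply. Qed.

Lemma trcl_min (x : V) (T : set V) : transitive_set T -> x `<=` T -> trcl x `<=` T.
Proof. by move=> tT xT y; apply. Qed.

Lemma opair_inj x y x' y' : opair x y = opair x' y' -> x = x' /\ y = y'.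
Proof.
move=> E; have xx : x = x'.
  have : vpair x x ∈ opair x' y' by rewrite -E; apply/in_vpair; left.
  have F z : vpair x x = vpair x' z -> x = x'.
    move=> F; have : x' ∈ vpair x x by rewrite F; apply/in_vpair; left.
    by case/in_vpair.
  by case/in_vpair=> /F.
subst x'; split=> //.
have : vpair x y ∈ opair x y' by rewrite -E; apply/in_vpair; right.
have : vpair x y' ∈ opair x y by rewrite E; apply/in_vpair; right.
have H u v : vpair x u = vpair x v -> u = v \/ u = x.
  move=> F; have : u ∈ vpair x v by rewrite -F; apply/in_vpair; right.
  by case/in_vpair; auto.
by do 2 case/in_vpair => /H[] ?; congruence.
Qed.

Lemma vsucc_sub (x : V) : x `<=` vsucc x.
Proof. by move=> y yx; apply/in_vsucc; left. Qed.

Lemma vsucc_self x : x ∈ vsucc x.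
Proof. by apply/in_vsucc; right. Qed.

Lemma in_omega x : x ∈ omega <-> exists n, x = vnat n.
Proof. exact: in_vsup. Qed.

Lemma vnat_omega n : vnat n ∈ omega.
Proof. by apply/in_omega; exists n. Qed.

Lemma ordinal_vnat n : ordinal (vnat n).
Proof.
elim: n => [|n IH] /=; last exact: ordinal_vsucc.
by apply: ordinalI => x /in_vempty.
Qed.

Lemma vnat_lt m n : (m < n)%N -> vnat m ∈ vnat n.
Proof.
elim: n => // n IH; rewrite ltnS leq_eqVlt => /orP[/eqP ->|/IH mn] /=.
  exact: vsucc_self.
exact: vsucc_sub.
Qed.

Lemma vnat_inj : injective vnat.
Proof.
by move=> m n; case: (ltngtP m n) => // /vnat_lt H E; rewrite E in H; case: (mem_irr H).
Qed.

Lemma ntuple_rcons s x : s != [::] -> ntuple (rcons s x) = opair (ntuple s) x.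
Proof. by case: s => //= y s _; rewrite -cats1 foldl_cat. Qed.

(** The lengths have to agree: a 1-tuple is its only component, so every pair is also a 1-tuple. *)
Lemma ntuple_inj s t : size s = size t -> ntuple s = ntuple t -> s = t.
Proof.
elim/last_ind: s t => [|s x IH] t; first by move/esym/size0nil.
case/lastP: t => [|t y]; first by rewrite size_rcons.
rewrite !size_rcons => -[st]; have [s0|sN] := eqVneq s [::].
  by move: st; rewrite s0 => /esym/size0nil -> /= ->.
have tN : t != [::] by rewrite -size_eq0 -st size_eq0.
by rewrite !ntuple_rcons // => /opair_inj[/IH -> // ->].
Qed.

Lemma in_vseq f x : x ∈ vseq f <-> exists n, x = opair (vnat n) (f n).
Proof. exact: in_vsup. Qed.

Lemma vseq_inj f g : vseq f = vseq g -> f = g.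
Proof.
move=> E; apply/funext => n; have : opair (vnat n) (f n) ∈ vseq g.
  by rewrite -E; apply/in_vseq; exists n.
by case/in_vseq => m /opair_inj[/vnat_inj <-].
Qed.

Lemma in_vfun a f x : x ∈ vfun a f <-> exists2 y, y ∈ a & x = opair y (f y).
Proof. exact: in_vimg. Qed.

Lemma vexp1 A : vexp A 1 = A.
Proof. by []. Qed.

Lemma vexp_sub (A B : V) k : A `<=` B -> vexp A k `<=` vexp B k.
Proof.
by move=> AB x /in_vexp[s [sk sA ->]]; apply/in_vexp; exists s; split=> // y /sA/AB.
Qed.

(** Cutting the recursive values off to [vempty] outside [z] lets [G] take a total function; no
    condition on [G] is then required. *)
Lemma mem_rec (G : V -> (V -> V) -> V) :
  exists F, forall z, F z = G z (fun u => if `[< u ∈ z >] then F u else vempty).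
Proof.
have wf : well_founded (fun u z => u ∈ z).
  by elim/V_ind => x IH; constructor.
pose step z (rec : forall u, u ∈ z -> V) :=
  G z (fun u => if pselect (u ∈ z) is left H then rec u H else vempty).
exists (Fix wf (fun=> V) step) => z; rewrite Fix_eq /step.
  by congr G; apply/funext => u; case: pselect => [H|H]; [rewrite asboolT|rewrite asboolF].
move=> x f g fg; congr G; apply/funext => u.
by case: pselect => // H; apply: fg.
Qed.

(** * The filtration of [H kappa^+] *)

(** The Tarski-Vaught condition for a single relation with two parameters. *)
Definition reflects (B D : set V) (R : V -> V -> V -> Prop) : Prop :=
  forall x y, B x -> B y -> (exists2 z, D z & R x y z) -> exists2 z, B z & R x y z.

Section Filtration.
Variables (kappa : V) (M : V -> V).
Local Notation kappa' := (vcard_succ kappa).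
Local Notation H := (Hset kappa').
Hypothesis kappa_reg : regular_uncountable kappa.

Lemma card_kappa : cardinal kappa.
Proof. by case: kappa_reg. Qed.

Lemma ord_kappa : ordinal kappa.
Proof. exact: card_kappa.1. Qed.

Lemma vnat_kappa n : vnat n ∈ kappa.
Proof. by case: kappa_reg => _ wk _; apply: ord_kappa.1 wk _ (vnat_omega n). Qed.

Lemma omega_le_kappa : omega #<= kappa.
Proof. by apply: subset_card_le => x /in_omega[n ->]; apply: vnat_kappa. Qed.

(** Regularity, applied to the constant function [x] on the one-element set [vnat 1], gives an
    ordinal of [kappa] above [x]. *)
Lemma vsucc_kappa x : x ∈ kappa -> vsucc x ∈ kappa.
Proof.
move=> xk; have ox := ordinal_in ord_kappa xk; have [_ _ kreg] := kappa_reg.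
have [|//|c ck /(_ (vnat 0)) xc] := kreg (vnat 1) (fun=> x); first exact: vnat_kappa.
have oc := ordinal_in ord_kappa ck.
apply: (ordinal_sub_in (ordinal_vsucc ox) oc ord_kappa _ ck).
have {}xc : x ∈ c by apply: xc; apply/in_vsucc; right.
move=> y /in_vsucc[|->//]; exact: oc.1 xc y.
Qed.

Lemma kappa_bound (A : set V) (f : V -> V) : A #< kappa ->
  (forall x, A x -> f x ∈ kappa) -> exists2 c, c ∈ kappa & forall x, A x -> f x ∈ c.
Proof.
move=> /(card_lt_ex card_kappa)[d dk dA] fk.
have /card_leE[g gd ginj] := card_eq_leR dA.
pose h i := xget vempty [set x | A x /\ g x = i].
have hg x : A x -> h (g x) = x.
  move=> Ax; have [] := @xgetPex _ vempty [set y | A y /\ g y = g x] (ex_intro _ x (conj Ax erefl)).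
  by rewrite -/(h (g x)) => Ah /ginj ->.
have [_ _ kreg] := kappa_reg.
have [i _|c ck cP] := kreg d (fun i => if `[< A (h i) >] then f (h i) else vempty) dk.
  by case: asboolP => [/fk//|_]; apply: (vnat_kappa 0).
by exists c => // x Ax; have := cP _ (gd _ Ax); rewrite hg // asboolT.
Qed.

Lemma card_kappa' : cardinal kappa'.
Proof. by case: (vcard_succP kappa). Qed.

Lemma ord_kappa' : ordinal kappa'.
Proof. exact: card_kappa'.1. Qed.

Lemma in_kappa' b : ordinal b -> b ∈ kappa' <-> b #<= kappa.
Proof. exact: in_vcard_succ. Qed.

Lemma kappa_kappa' : kappa ∈ kappa'.
Proof. by apply/in_kappa'; [exact: ord_kappa|exact: card_lexx]. Qed.

(** A surjection from [kappa]: even numbers go to the left copy of omega, odd ones to the right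
    copy, and all other elements stay in place. *)
Lemma kappa_sum : (inl @` kappa `|` inr @` omega : set (V + V)) #<= kappa.
Proof.
pose f x : V + V := if pselect (exists n, x = vnat n) is left e then
  let n := sval (cid e) in
  if odd n then inr (vnat n./2) else inl (vnat n./2) else inl x.
have fE n : f (vnat n) = if odd n then inr (vnat n./2) else inl (vnat n./2).
  rewrite /f; case: pselect => [e|[]]; last by exists n.
  by case: (cid e) => m /= /vnat_inj ->.
apply: (@card_le_surj _ _ _ f) => _ [[x xk <-]|[x /in_omega[n ->] <-]].
  have [[n nE]|xN] := pselect (exists n, x = vnat n).
    by subst x; exists (vnat n.*2); [exact: vnat_kappa|rewrite fE odd_double doubleK].
  by exists x => //; rewrite /f; case: pselect.
by exists (vnat n.*2.+1); [exact: vnat_kappa|rewrite fE /= odd_double /= uphalf_double].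
Qed.

Hypothesis nfM : nice_filtration kappa' M H.

Lemma H_transitive : transitive_set H.
Proof. by case: nfM => -[]. Qed.

Lemma vsucc_kappa' x : x ∈ kappa' -> vsucc x ∈ kappa'.
Proof. by case: nfM => -[_ [_ h]] _ _ _ _; apply: h. Qed.

Lemma M_transitive b : b ∈ kappa' -> transitive_set (M b).
Proof. by move=> bk; case: nfM => _ _ _ _ /(_ b bk)[]. Qed.

Lemma M_ordinal b x : b ∈ kappa' -> (x ∈ M b /\ ordinal x) <-> x ∈ b.
Proof. by move=> bk; case: nfM => _ _ _ _ /(_ b bk)[]. Qed.

Lemma M_in a b : a ∈ b -> b ∈ kappa' -> M a ∈ M b.
Proof. by move=> ab bk; case: nfM => _ _ /(_ a b ab bk). Qed.

Lemma M_sub (a b : V) : a `<=` b -> ordinal a -> b ∈ kappa' -> M a `<=` M b.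
Proof.
move=> ab oa bk; have ob := ordinal_in ord_kappa' bk.
case: (iffLR (ordinal_sub oa ob) ab) => [{}ab|->//].
by apply: M_transitive => //; apply: M_in.
Qed.

Lemma sub_M b : b ∈ kappa' -> b `<=` M b.
Proof. by move=> bk x /(M_ordinal _ bk)[]. Qed.

Lemma M_H b : b ∈ kappa' -> M b `<=` H.
Proof. by move=> bk x xb; case: nfM => _ <- _ _ _; exists b. Qed.

Lemma H_M x : H x -> exists2 b, b ∈ kappa' & x ∈ M b.
Proof. by case: nfM => _ <- _ _ _. Qed.

Lemma M_card b : b ∈ kappa' -> M b #<= kappa.
Proof.
move=> bk; have ob := ordinal_in ord_kappa' bk.
have Mb : M b #<= (inl @` b `|` inr @` omega : set (V + V)).
  by case: nfM => _ _ _ _ /(_ b bk)[].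
apply: card_le_trans Mb _.
have [f fk finj] : exists2 f : V -> V, forall x, x ∈ b -> f x ∈ kappa &
  forall x y, x ∈ b -> y ∈ b -> f x = f y -> x = y by apply: card_leE; apply/in_kappa'.
have [g gk ginj] := card_leE kappa_sum.
pose h (u : V + V) := g (match u with inl x => inl (f x) | inr x => inr x end).
have Sl x : x ∈ b -> (inl @` kappa `|` inr @` omega : set (V + V)) (inl (f x)).
  by move=> /fk fx; left; exists (f x).
have Sr x : x ∈ omega -> (inl @` kappa `|` inr @` omega : set (V + V)) (inr x).
  by move=> xw; right; exists x.
apply: (@card_leI _ _ _ h); rewrite /h.
  by move=> _ [[x /Sl xb <-]|[x /Sr xw <-]]; apply: gk.
move=> _ _ [[x xb <-]|[x xw <-]] [[y yb <-]|[y yw <-]].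
- by move=> /(ginj _ _ (Sl _ xb) (Sl _ yb))[/(finj _ _ xb yb) ->].
- by move=> /(ginj _ _ (Sl _ xb) (Sr _ yw)).
- by move=> /(ginj _ _ (Sr _ xw) (Sl _ yb)).
- by move=> /(ginj _ _ (Sr _ xw) (Sr _ yw))[->].
Qed.

Lemma kappa_max x y : x ∈ kappa -> y ∈ kappa -> exists z, [/\ z ∈ kappa, x ∈ z & y ∈ z].
Proof.
move=> xk yk; have sk := vsucc_kappa.
case: (ordinal_total (ordinal_in ord_kappa xk) (ordinal_in ord_kappa yk)) => xy.
- by exists (vsucc x); split; [exact: sk|exact: vsucc_self|rewrite xy; exact: vsucc_self].
- by exists (vsucc y); split; [exact: sk|exact: vsucc_sub|exact: vsucc_self].
- by exists (vsucc x); split; [exact: sk|exact: vsucc_self|exact: vsucc_sub].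
Qed.

(** For [z] in [kappa] above [x] and [y], adding [{x}], [{x, y}] and the pair itself to [z] gives a
    transitive class of size less than [kappa]. *)
Lemma Hkappa_opair x y : x ∈ kappa -> y ∈ kappa -> Hset kappa (opair x y).
Proof.
move=> xk yk.
have [z [zk xz yz]] := kappa_max xk yk; have oz := ordinal_in ord_kappa zk.
pose T := [set t | [\/ t ∈ z, t = vpair x x, t = vpair x y | t = opair x y]].
have tT : transitive_set T.
  move=> t [tz|->|->|->] u.
  - by move=> ut; constructor 1; apply: oz.1 ut.
  - by case/in_vpair=> ->; constructor 1.
  - by case/in_vpair=> ->; constructor 1.
  - by case/in_vpair=> ->; [constructor 2|constructor 3].
have trT : trcl (opair x y) `<=` T.
  by apply: trcl_min => // t; apply: tT; constructor 4.
apply: card_le_lt_trans (subset_card_le trT) _.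
apply: (@card_le_lt_trans _ (vsucc (vsucc (vsucc z)))); last first.
  by apply: card_elem card_kappa _; do 3 apply: vsucc_kappa.
(* The three added sets are the values at [z], [z + 1] and [z + 2], so [z + 3] maps onto [T]. *)
pose f u := if `[< u ∈ z >] then u else if `[< u = z >] then vpair x x else
  if `[< u = vsucc z >] then vpair x y else opair x y.
have sz : vsucc z <> z by move=> E; apply: (@mem_irr z); rewrite -{1}E; exact: vsucc_self.
have ssz : vsucc (vsucc z) <> vsucc z.
  by move=> E; apply: (@mem_irr (vsucc z)); rewrite -{1}E; exact: vsucc_self.
have szz : ~ vsucc z ∈ z by move=> /mem_asym; apply; exact: vsucc_self.
have zsz : z ∈ vsucc (vsucc z) by apply: vsucc_sub; exact: vsucc_self.
apply: (@card_le_surj _ _ _ f) => t [tz|->|->|->]; rewrite /f.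
- by exists t; [do 3 apply: vsucc_sub|rewrite asboolT].
- exists z; first exact: vsucc_sub.
  by rewrite asboolF ?asboolT //; exact: mem_irr.
- exists (vsucc z); first by apply: vsucc_sub; exact: vsucc_self.
  by rewrite asboolF // asboolF // asboolT.
- exists (vsucc (vsucc z)); first exact: vsucc_self.
  rewrite !asboolF //; last by move/mem_asym; apply.
  by move=> E; apply: (@mem_irr z); rewrite -{1}E.
Qed.

Hypothesis M_kappa : M kappa = Hset kappa :> set V.

(** Below [kappa], pairs stay in [Hset kappa = M kappa], which has size at most [kappa]. *)
Lemma kappa_square : vprod kappa kappa #<= kappa.
Proof.
apply: card_le_trans (M_card kappa_kappa'); apply: subset_card_le.
move=> _ /in_vprod[x [y [xk yk ->]]]; rewrite M_kappa; exact: Hkappa_opair.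
Qed.

(** Send [x] to the pair of the index of some [t] in [y] containing [x] and the place of [x] in an
    enumeration chosen for [t]. *)
Lemma card_vUnion_le (y : V) : y #<= kappa -> (forall t, t ∈ y -> t #<= kappa) ->
  vUnion y #<= kappa.
Proof.
move=> yk tk; have [s sk sinj] := card_leE yk.
have /choice[h hP] t : exists f : V -> V, t ∈ y -> 
    (forall x, x ∈ t -> f x ∈ kappa) /\ forall x u, x ∈ t -> u ∈ t -> f x = f u -> x = u.
  have [ty|ty] := pselect (t ∈ y); last by exists id => /ty.
  by have [f ? ?] := card_leE (tk t ty); exists f.
apply: card_le_trans kappa_square.
have /choice[c cP] x : exists t, x ∈ vUnion y -> t ∈ y /\ x ∈ t.
  have [/in_vUnion[t ty xt]|xN] := pselect (x ∈ vUnion y); first by exists t.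
  by exists vempty => /xN.
apply: (@card_leI _ _ _ (fun x => opair (s (c x)) (h (c x) x))) => [x /cP[cy xc]|x u /cP[cy xc] /cP[cy' uc]].
  apply/in_vprod; exists (s (c x)), (h (c x) x); split=> //; first exact: sk.
  by have [+ _] := hP _ cy; apply.
move=> /opair_inj[/(sinj _ _ cy cy') E]; rewrite -E in uc *.
by have [_ hinj] := hP _ cy; apply: hinj.
Qed.

(** Regularity of the successor of [kappa]: the supremum of [y] is a union of at most [kappa] many
    sets of size at most [kappa]. *)
Lemma kappa'_bound (y : V) : y `<=` kappa' -> y #<= kappa ->
  exists2 c, c ∈ kappa' & y `<=` c.
Proof.
move=> yk' yk; have oU : ordinal (vUnion y).
  by apply: ordinal_vUnion => x /yk' /(ordinal_in ord_kappa').
exists (vsucc (vUnion y)); last first.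
  move=> x xy; apply/in_vsucc.
  apply: (iffLR (ordinal_sub _ oU)); first exact: ordinal_in ord_kappa' (yk' _ xy).
  by move=> z zx; apply/in_vUnion; exists x.
apply: vsucc_kappa'; apply/in_kappa' => //; apply: card_vUnion_le => // t /yk' tk.
by apply/in_kappa' => //; apply: ordinal_in ord_kappa' tk.
Qed.

(** * Closure properties of the sets hereditarily of size at most [kappa] *)

Lemma H_card (x : V) : H x -> x #<= kappa.
Proof.
move=> /(proj1 (card_lt_succ _ _)) /(card_le_trans _); apply.
by apply: subset_card_le; apply: trcl_sub.
Qed.

(** The stages at which the elements of [y] appear are bounded by some [c], so the transitive
    closure of [y] is contained in [M c], which has size at most [kappa]. *)
Lemma H_intro (y : V) : y `<=` H -> y #<= kappa -> H y.
Proof.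
move=> yH yk; have /choice[b bP] x : exists b, H x -> b ∈ kappa' /\ x ∈ M b.
  have [/H_M[b bk xb]|xN] := pselect (H x); first by exists b.
  by exists vempty => /xN.
have [c ck cP] : exists2 c, c ∈ kappa' & vimg b y `<=` c.
  apply: kappa'_bound; first by move=> _ /in_vimg[x /yH/bP[] ? _ ->].
  apply: card_le_trans yk; apply: (@card_le_surj _ _ _ b) => z /in_vimg[x xy ->].
  by exists x.
have yc : y `<=` M c.
  move=> x xy; have [bk xb] := bP _ (yH _ xy).
  have bc : b x ∈ c by apply: cP; apply/in_vimg; exists x.
  have oc := ordinal_in ord_kappa' ck; have ob := ordinal_in oc bc.
  by apply: M_sub xb => //; apply: oc.1.
apply/card_lt_succ; apply: card_le_trans (M_card ck); apply: subset_card_le.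
exact: trcl_min (M_transitive ck) yc.
Qed.

Lemma H_sub (x y : V) : H x -> y `<=` x -> H y.
Proof.
move=> Hx yx; apply: H_intro; first by move=> z /yx; apply: H_transitive Hx _.
by apply: card_le_trans (H_card Hx); apply: subset_card_le.
Qed.

Lemma H_vempty : H vempty.
Proof. by apply: H_intro => [x /in_vempty//|]; apply: subset_card_le => x /in_vempty. Qed.

Lemma H_vpair x y : H x -> H y -> H (vpair x y).
Proof.
move=> Hx Hy; apply: H_intro => [z /in_vpair[] ->//|].
apply: (@card_le_surj _ _ _ (fun u => if `[< u = vempty >] then x else y)).
move=> z /in_vpair[] ->; first by exists (vnat 0); [exact: vnat_kappa|rewrite asboolT].
exists (vnat 1); first exact: vnat_kappa.
by rewrite asboolF // => E; apply: (@in_vempty vempty); rewrite -{1}E; exact: vsucc_self.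
Qed.

Lemma H_opair x y : H x -> H y -> H (opair x y).
Proof. by move=> Hx Hy; do !apply: H_vpair. Qed.

Lemma H_vUnion x : H x -> H (vUnion x).
Proof.
move=> Hx; apply: H_intro.
  by move=> y /in_vUnion[z zx]; apply: H_transitive (H_transitive Hx zx) _.
apply: card_vUnion_le; first exact: H_card.
by move=> t /(H_transitive Hx)/H_card.
Qed.

Lemma H_vU x y : H x -> H y -> H (vU x y).
Proof. by move=> Hx Hy; apply: H_vUnion; apply: H_vpair. Qed.

Lemma H_vimg f (x : V) : H x -> (forall y, y ∈ x -> H (f y)) -> H (vimg f x).
Proof.
move=> Hx Hf; apply: H_intro; first by move=> _ /in_vimg[y /Hf ? ->].
apply: card_le_trans (H_card Hx); apply: (@card_le_surj _ _ _ f) => z /in_vimg[y yx ->].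
by exists y.
Qed.

Lemma H_ordinal x : x ∈ kappa' -> H x.
Proof.
move=> xk; apply: (M_H (vsucc_kappa' xk)); apply: sub_M (vsucc_kappa' xk) _ (vsucc_self x).
Qed.

Lemma H_vnat n : H (vnat n).
Proof. by apply: H_ordinal; apply: ord_kappa'.1 kappa_kappa' _ (vnat_kappa n). Qed.

Lemma H_vseq f : (forall n, H (f n)) -> H (vseq f).
Proof.
move=> Hf; apply: H_intro => [_ /in_vseq[n ->]|].
  by apply: H_opair => //; apply: H_vnat.
apply: card_le_trans omega_le_kappa.
apply: (@card_leI _ _ _ (fun x => xget vempty [set u | exists n, u = vnat n /\ x = opair u (f n)])).
  move=> _ /in_vseq[n ->]; case: xgetP => [x _ [m [-> _]]|_]; first exact: vnat_omega.
  exact: (vnat_omega 0).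
move=> _ _ /in_vseq[n ->] /in_vseq[m ->].
have E i : xget vempty [set u | exists n, u = vnat n /\ opair (vnat i) (f i) = opair u (f n)] = vnat i.
  case: xgetP => [x _ [j [-> /opair_inj[]//]]|/(_ (vnat i))[]].
  by exists i.
by rewrite !E => /vnat_inj ->.
Qed.

Lemma H_pr_closed : pr_closed H.
Proof.
move=> n F; elim=> {n F}.
- by move=> n i x; apply.
- by move=> n x _; apply: H_vempty.
- move=> n F G _ IF _ IG x Hx; apply: H_vU; first exact: IF.
  by apply: H_vpair; apply: IG.
- by move=> n F G P Q _ IF _ IG _ _ _ _ x Hx; case: ifP => _; [exact: IF|exact: IG].
- move=> m n G F _ IG _ IF x Hx; apply: IG => i; rewrite tnth_mktuple.
  exact: IF.
- move=> n G F _ IG FE x; case/tupleP: x => z x Hx.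
  have Hz : H z by have := Hx ord0.
  have {}Hx i : H (tnth x i) by have := Hx (lift ord0 i); rewrite tnthS.
  have {}Hx z' : H z' -> forall i, H (tnth [tuple of z' :: x] i).
    by move=> Hz' i; case: (unliftP ord0 i) => [j|] ->; rewrite ?tnthS.
  elim/V_ind: z Hz => z IH Hz; rewrite FE; apply: IG => i.
  case: (unliftP ord0 i) => [j|] ->; rewrite ?tnthS; first exact: Hx.
  apply: H_vUnion; apply: H_vimg => // u uz; apply: IH => //.
  exact: H_transitive Hz _ uz.
Qed.

Lemma M_limit b x : b ∈ kappa' -> limit_ordinal b -> b <> vempty ->
  x ∈ M b -> exists2 a, a ∈ b & x ∈ M a.
Proof.
move=> bk lb b0; case: nfM => _ _ _ /(_ b bk lb b0) E _.
by rewrite E => -[a ab xa]; exists a.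
Qed.

(** A Skolem closure along the filtration: pass omega times from [g] to a stage containing witnesses
    for all parameters in [M g]. At the limit [gamma], each parameter lies in some earlier stage. *)
Lemma M_reflects (P : nat -> V -> V -> V -> Prop) p : H p ->
  exists gamma, [/\ gamma ∈ kappa', kappa ∈ gamma, p ∈ M gamma
    & forall t, reflects (M gamma) H (P t)].
Proof.
move=> /H_M[g0 g0k pg0].
(* [w] is a stage at which a witness appears; [kappa] is only a default. *)
have /choice[w wP] (q : V * V * nat) : exists g, g ∈ kappa' /\
   ((exists2 z, H z & P q.2 q.1.1 q.1.2 z) -> exists2 z, z ∈ M g & P q.2 q.1.1 q.1.2 z).
  have [[z Hz Pz]|Nz] := pselect (exists2 z, H z & P q.2 q.1.1 q.1.2 z).
    by have [g gk zg] := H_M Hz; exists g; split=> // _; exists z.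
  by exists kappa; split=> //; exact: kappa_kappa'.
have /choice[s sP] (g : V) : exists g', g ∈ kappa' -> [/\ g' ∈ kappa', g ∈ g' &
    forall t x y, x ∈ M g -> y ∈ M g -> w (x, y, t) ∈ g'].
  have [gk|gN] := pselect (g ∈ kappa'); last by exists vempty => /gN.
  (* [Y] collects the stages of the witnesses, together with [g] itself to make the bound exceed
     [g]. *)
  pose Y := vU (vpair g g) (vsup (fun q : idx (M g) * idx (M g) * nat => w (elt q.1.1, elt q.1.2, q.2))).
  have HMg : H (M g) by apply: (M_H (vsucc_kappa' gk)); apply: M_in (vsucc_self g) (vsucc_kappa' gk).
  have Yk' : Y `<=` kappa'.
    by move=> x /in_vU[/in_vpair[]->//|/in_vsup[q ->]]; case: (wP (elt q.1.1, elt q.1.2, q.2)).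
  have HN : H (vsup vnat).
    apply: H_intro; first by move=> x /in_vsup[n ->]; apply: H_vnat.
    exact: omega_le_kappa.
  have HY : H Y.
    apply: H_vU; first by apply: H_vpair; apply: H_ordinal.
    (* The triples [(t, (x, y))] with [x], [y] in [M g] form an element of [H], and the stages in
       [Y] are values of a function on it. *)
    have HR : H (vimg (fun x => vimg (opair x) (M g)) (M g)).
      apply: H_vimg => // x xg; apply: H_vimg => // y yg.
      by apply: H_opair; apply: (M_H gk).
    pose Q := vimg (fun n => vimg (opair n) (vUnion (vimg (fun x => vimg (opair x) (M g)) (M g)))) omega.
    have HQ : H (vUnion Q).
      apply: H_vUnion; apply: H_vimg => // n nw; apply: H_vimg; first exact: H_vUnion.
      move=> y yR; apply: H_opair; first by have /in_omega[m ->] := nw; apply: H_vnat.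
      exact: H_transitive (H_vUnion HR) _ yR.
    pose f u := xget vempty [set v | exists x y t, u = opair (vnat t) (opair x y) /\ v = w (x, y, t)].
    have fE x y t : f (opair (vnat t) (opair x y)) = w (x, y, t).
      rewrite /f; case: xgetP => [v _ [x' [y' [t' [/opair_inj[/vnat_inj -> /opair_inj[-> ->]] ->]]]]//|].
      by move=> /(_ (w (x, y, t)))[]; exists x, y, t.
    apply: (@H_sub (vimg f (vUnion Q))); last first.
      move=> _ /in_vsup[[[i j] t] ->] /=; apply/in_vimg.
      exists (opair (vnat t) (opair (elt i) (elt j))); last by rewrite fE.
      apply/in_vUnion; eexists.
        by apply/in_vimg; exists (vnat t); [exact: vnat_omega|reflexivity].
      apply/in_vimg; exists (opair (elt i) (elt j)) => //; apply/in_vUnion; eexists.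
        by apply/in_vimg; exists (elt i); [exists i|reflexivity].
      by apply/in_vimg; exists (elt j) => //; exists j.
    apply: H_vimg => // _ /in_vUnion[_ /in_vimg[n _ ->] /in_vimg[y _ ->]].
    rewrite /f; case: xgetP => [_ _ [x [y' [t [_ ->]]]]|_]; last exact: H_vempty.
    by apply: H_ordinal; case: (wP (x, y', t)).
  have [c ck Yc] := kappa'_bound Yk' (H_card HY).
  exists c => _; split=> //; first by apply: Yc; apply/in_vU; left; apply/in_vpair; left.
  move=> t x y [i _ <-] [j _ <-]; apply: Yc; apply/in_vU; right; apply/in_vsup.
  by exists (i, j, t).
(* The iteration starts above [kappa] and above a stage containing [p]. *)
pose G n := iter n s (vsucc (vU g0 kappa)).
have oU : ordinal (vU g0 kappa).
  by apply: ordinal_vUnion => x /in_vpair[] ->; [exact: ordinal_in ord_kappa' g0k|exact: ord_kappa].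
have G0 : G 0 ∈ kappa'.
  apply: vsucc_kappa'; apply/in_kappa' => //; apply: card_vUnion_le.
    by apply: H_card; apply: H_vpair; apply: H_ordinal => //; exact: kappa_kappa'.
  move=> x /in_vpair[]->; last exact: card_lexx.
  by apply/in_kappa' => //; exact: ordinal_in ord_kappa' g0k.
have Gk n : G n ∈ kappa' by elim: n => // n /sP[].
have GS n : G n ∈ G n.+1 by have [] := sP _ (Gk n).
have oG n := ordinal_in ord_kappa' (Gk n).
have Gmono m n : (m <= n)%N -> G m `<=` G n.
  elim: n => [|n IH]; first by rewrite leqn0 => /eqP ->.
  rewrite leq_eqVlt => /orP[/eqP ->//|/IH mn x /mn]; exact: (oG n.+1).1 (GS n) x.
pose gam := vUnion (vsup G).
have Ggam n : G n ∈ gam by apply/in_vUnion; exists (G n.+1) => //; apply/in_vsup; exists n.+1.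
have ogam : ordinal gam by apply: ordinal_vUnion => x /in_vsup[n ->].
have gk : gam ∈ kappa'.
  have [||c ck cP] := @kappa'_bound (vsup G).
  - by move=> x /in_vsup[n ->].
  - apply: card_le_trans omega_le_kappa.
    apply: (@card_le_surj _ _ _ (fun u => G (xget 0%N [set n | u = vnat n]))) => x /in_vsup[n ->].
    exists (vnat n); first exact: vnat_omega.
    case: xgetP => [m _ /vnat_inj -> //|/(_ n)[]//].
  have oc := ordinal_in ord_kappa' ck.
  apply: (ordinal_sub_in ogam oc ord_kappa' _ ck).
  move=> x /in_vUnion[y /cP yc xy]; exact: oc.1 yc _ xy.
have lgam : limit_ordinal gam.
  split=> // y /in_vUnion[_ /in_vsup[n ->] yn]; apply/in_vUnion; exists (G n.+1).
    by apply/in_vsup; exists n.+1.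
  apply: ordinal_sub_in (ordinal_vsucc (ordinal_in (oG n) yn)) (oG n) (oG n.+1) _ (GS n).
  by move=> z /in_vsucc[|->//]; apply: (oG n).1.
have gam0 : gam <> vempty by move=> E; have := Ggam 0; rewrite E => /in_vempty.
have Mgam x : x ∈ M gam -> exists n, forall m, (n <= m)%N -> x ∈ M (G m).
  move=> /(M_limit gk lgam gam0)[a /in_vUnion[_ /in_vsup[n ->] an] xa].
  have oa := ordinal_in (oG n) an.
  exists n => m nm; apply: M_sub xa => //.
  by move=> y ya; apply: Gmono nm _ _; apply: (oG n).1 an _ ya.
exists gam; split=> //.
- apply: ogam.1 (Ggam 0) _ _; apply/in_vsucc.
  apply: (iffLR (ordinal_sub ord_kappa oU)).
  by move=> x xk; apply/in_vU; right.
- have sub : g0 `<=` gam.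
    move=> x xg; apply: ogam.1 (Ggam 0) _ _; apply: vsucc_sub.
    by apply/in_vU; left.
  by apply: M_sub pg0 => //; exact: ordinal_in ord_kappa' g0k.
- move=> t x y /Mgam[n xn] /Mgam[m ym] /(proj2 (wP (x, y, t)))/=[z zw Pz].
  exists z => //; have [_ _ /(_ t x y)] := sP _ (Gk (maxn n m)).
  move=> /(_ (xn _ (leq_maxl _ _)) (ym _ (leq_maxr _ _))) wG.
  have wgam : w (x, y, t) ∈ gam.
    by apply/in_vUnion; exists (G (maxn n m).+1) => //; apply/in_vsup; exists (maxn n m).+1.
  by apply: M_sub zw => //; [apply: ogam.1|exact: ordinal_in ogam wgam].
Qed.

End Filtration.

(** * Hulls from local club condensation *)

(** The properties of a term [B] of an LCC sequence that are used later. [hull_filt] is what remains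
    of the collapse respecting the filtration: every earlier stage of the collapse is the image of a
    stage belonging to [B]. *)
Record hull (kappa : V) (M : V -> V) (gamma delta delta' B : V) (pi : V -> V) : Prop := {
  hull_sub : B `<=` M gamma;
  hull_delta : delta ∈ kappa;
  hull_limit : limit_ordinal delta;
  hull_delta0 : delta <> vempty;
  hull_kappa : forall x, (x ∈ B /\ x ∈ kappa) <-> x ∈ delta;
  hull_delta' : delta' ∈ kappa;
  hull_card : M delta' #= delta;
  hull_mostowski : mostowski B pi;
  hull_img : vimg pi B = M delta';
  hull_filt : forall xi, xi ∈ delta' -> exists zeta,
    [/\ zeta ∈ B, ordinal zeta, M zeta ∈ B, pi zeta = xi & pi (M zeta) = M xi]
}.

(** * Clubs of closure points *)

Section Clubs.
Variables (kappa : V).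
Hypothesis kappa_reg : regular_uncountable kappa.

Lemma kappa_bound_nat (a : nat -> V) : (forall n, a n ∈ kappa) ->
  exists2 c, c ∈ kappa & forall n, a n ∈ c.
Proof.
move=> ak; pose f x := a (xget 0%N [set n | x = vnat n]).
have fE n : f (vnat n) = a n.
  by rewrite /f; case: xgetP => [m _ /vnat_inj -> //|/(_ n)[]].
have [||c ck cP] := @kappa_bound _ kappa_reg omega f.
- by apply: card_elem; case: kappa_reg.
- by move=> x /in_omega[n ->]; rewrite fE.
by exists c => // n; rewrite -fE; apply: cP; apply: vnat_omega.
Qed.

Lemma club_closed (g : V -> V) : (forall i, i ∈ kappa -> g i ∈ kappa) ->
  club kappa (vsep kappa (fun d => [/\ limit_ordinal d, d <> vempty &
    forall i, i ∈ d -> g i ∈ d])).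
Proof.
move=> gk; have ok := ord_kappa kappa_reg; split.
- by move=> d /in_vsep[].
- move=> a ak.
  (* Iterating [h] omega times from above [a] gives an increasing sequence whose supremum is closed
     under [g]; it is below [kappa] because [kappa] is regular and uncountable. *)
  have /choice[h hP] x : exists y, x ∈ kappa ->
      [/\ y ∈ kappa, vsucc x ∈ y & forall i, i ∈ x -> g i ∈ y].
    have [xk|xN] := pselect (x ∈ kappa); last by exists vempty => /xN.
    have [i ix|c ck cP] := kappa_bound kappa_reg (card_elem (card_kappa kappa_reg) xk) (f := g).
      by apply: gk; apply: ok.1 ix.
    have [y [yk cy xy]] := kappa_max kappa_reg ck (vsucc_kappa kappa_reg xk).
    by exists y => _; split=> // i /cP ic; apply: (ordinal_in ok yk).1 cy _ ic.
  pose s n := iter n h (vsucc a).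
  have sk n : s n ∈ kappa by elim: n => [|n /hP[]//]; apply: vsucc_kappa.
  have os n := ordinal_in ok (sk n).
  have sS n : vsucc (s n) ∈ s n.+1 by have [] := hP _ (sk n).
  have sS' n : s n ∈ s n.+1 by apply: (os n.+1).1 (sS n) _ (vsucc_self _).
  have [c ck cP] := kappa_bound_nat sk; have oc := ordinal_in ok ck.
  have od : ordinal (vUnion (vsup s)) by apply: ordinal_vUnion => x /in_vsup[n ->].
  have sd n : s n ∈ vUnion (vsup s).
    by apply/in_vUnion; exists (s n.+1) => //; apply/in_vsup; exists n.+1.
  exists (vUnion (vsup s)); last by apply: od.1 (sd 0) _ (vsucc_self a).
  apply/in_vsep; split; first last.
    split.
    + split=> // y /in_vUnion[_ /in_vsup[n ->] yn]; apply/in_vUnion; exists (s n.+1).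
        by apply/in_vsup; exists n.+1.
      apply: (ordinal_sub_in (ordinal_vsucc (ordinal_in (os n) yn)) (os n) (os n.+1)) => //.
      by move=> z /in_vsucc[|->//]; apply: (os n).1.
    + by move=> E; have := sd 0; rewrite E => /in_vempty.
    + move=> i /in_vUnion[_ /in_vsup[n ->] yn]; apply/in_vUnion; exists (s n.+1).
        by apply/in_vsup; exists n.+1.
      by have [_ _] := hP _ (sk n); apply.
  apply: (ordinal_sub_in od oc ok) => // x /in_vUnion[_ /in_vsup[n ->]].
  exact: oc.1 (cP n) x.
- move=> d dk ld d0 dE; apply/in_vsep; split=> //; split=> // i /dE[b [/in_vsep[_ [_ _ bg]] bd ib]].
  by apply: ld.1.1 bd _ _; apply: bg.
Qed.

End Clubs.

(** * Hulls as terms of an LCC sequence *)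

Section Hull.
Variables (kappa : V) (M : V -> V).
Local Notation kappa' := (vcard_succ kappa).
Local Notation H := (Hset kappa').
Hypothesis kappa_reg : regular_uncountable kappa.
Hypothesis nfM : nice_filtration kappa' M H.
Hypothesis M_kappa : M kappa = Hset kappa :> set V.
Hypothesis lccM : witnesses_LCC kappa kappa' kappa' M.
Variable gamma : V.
Hypothesis gamma_in : gamma ∈ kappa'.
Hypothesis kappa_gamma : kappa ∈ gamma.
Hypothesis opair_gamma : forall x y, x ∈ M gamma -> y ∈ M gamma -> opair x y ∈ M gamma.

Lemma H_Mb b : b ∈ kappa' -> H (M b).
Proof.
move=> bk; have sb := vsucc_kappa' nfM bk.
by apply: (M_H nfM sb); apply: (M_in nfM (vsucc_self b) sb).
Qed.

Lemma vcard_gamma : vcard gamma = kappa.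
Proof.
have og := ordinal_in (ord_kappa' _) gamma_in.
apply: is_card_uniq (vcardP gamma) _; split; first exact: card_kappa.
apply: card_eqI; last by apply/in_kappa'.
by apply: subset_card_le; apply: og.1.
Qed.

(** The relations are given to LCC as ternary predicates, for which elementarity yields reflection.
    By continuity of the sequence, its term at a closure point [d] of a function bounding the traces
    on [kappa] has trace exactly [d]. *)
Lemma hull_ex (P : nat -> V -> V -> V -> Prop) p : p ∈ M gamma ->
  exists2 E, club kappa E & forall delta, delta ∈ E ->
    exists delta' B pi, [/\ hull kappa M gamma delta delta' B pi, p ∈ B &
      forall t, reflects B (M gamma) (P t)].
Proof.
move=> pg; have ok := ord_kappa kappa_reg; have ck := card_kappa kappa_reg.
have og := ordinal_in (ord_kappa' _) gamma_in.
have [s sk sinj] := card_leE (M_card kappa_reg nfM gamma_in).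
(* [Q 0] makes [B] no larger than [B ∩ kappa]. *)
pose Q n x y z := if n is t.+1 then P t x y z else z = s x.
pose F n := vsep (vexp (M gamma) 3) (fun u => exists x y z, u = ntuple [:: x; y; z] /\ Q n x y z).
(* Closure of [M gamma] under pairs keeps the triples inside it, so the sequence of predicates
   belongs to [H], as LCC demands. *)
have Fg n : F n `<=` M gamma.
  move=> u /in_vsep[/in_vexp[[|x [|y [|z [|t l]]]] [] // _ xyz ->] _] /=.
  by do 2?[apply: opair_gamma]; apply: xyz; rewrite !inE eqxx ?orbT.
have HF : H (vseq (fun n => opair (F n) (vnat 3))).
  apply: (H_vseq kappa_reg nfM M_kappa) => n; apply: (H_opair kappa_reg nfM M_kappa); last exact: (H_vnat kappa_reg nfM).
  exact: H_sub kappa_reg nfM M_kappa _ _ (H_Mb gamma_in) (Fg n).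
have HU : H = filtration_union kappa' M by case: nfM.
case: lccM => _ _ _ /(_ gamma F (fun=> 3) kappa_gamma gamma_in).
rewrite -HU => /(_ HF) [|Bs []]; first by move=> n u /in_vsep[].
rewrite vcard_gamma => _ Bel Bsz Bcol [Bmono Blim Bun].
have Bsub i : i ∈ kappa -> Bs i `<=` M gamma by move=> /Bel[].
have Brefl i t : i ∈ kappa -> reflects (Bs i) (M gamma) (Q t).
  move=> ik x y xB yB [z zg Pz].
  (* The formula is [exists z, F t (x, y, z)], written without an existential quantifier. The bound
     [z] has index 0, so that [x] and [y] have indices 1 and 2. *)
  have [_ /(_ 2 (Imp (All (Imp (@Rel (lcc_language (fun=> 3)) 3 (lcc_pred t)
    [tuple (lift ord0 ord0); ord_max; ord0]) (Bot _ _))) (Bot _ _)) [tuple x; y])] := Bel _ ik.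
  case=> [j|_ /= Hel].
    by case: (unliftP ord0 j) => [l ->|->] //; rewrite tnthS; case: (unliftP ord0 l) => [[]//|->].
  have xyzF : ntuple [:: x; y; z] ∈ F t.
    apply/in_vsep; split; last by exists x, y, z.
    apply/in_vexp; exists [:: x; y; z]; split=> // u; rewrite !inE.
    by case/or3P => /eqP -> //; apply: (Bsub _ ik).
  apply: contrapT => zN; apply: Hel.
    by move=> /(_ z zg); apply; rewrite !(tnth_nth vempty).
  move=> z' zB; rewrite !(tnth_nth vempty) /= => /in_vI[/in_vsep[_ [x' [y' [z'' [E Qz]]]]] _].
  have [xE yE zE] := @ntuple_inj [:: x; y; z'] [:: x'; y'; z''] erefl E; subst x' y' z''.
  by apply: zN; exists z'.
have [i0 i0k pi0] : exists2 i, i ∈ kappa & p ∈ Bs i.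
  by move: pg; rewrite -Bun.
(* Since [Bs i] has size less than [gamma], and [gamma] has size at most [kappa], the trace of
   [Bs i] on [kappa] is bounded. Values above [i0] ensure that closure points see [p]. *)
have /choice[g gP] i : exists j, i ∈ kappa -> [/\ j ∈ kappa, i0 ∈ j &
    forall x, x ∈ Bs i -> x ∈ kappa -> x ∈ j].
  have [ik|iN] := pselect (i ∈ kappa); last by exists vempty => /iN.
  have gk : gamma #<= kappa by apply/in_kappa'.
  have [|x []//|c ck' cP] := @kappa_bound _ kappa_reg [set x | x ∈ Bs i /\ x ∈ kappa] id.
    apply: card_le_lt_trans (card_lt_le_trans (proj2 (Bsz i ik)) gk).
    by apply: subset_card_le => x [].
  have [j [jk cj ij]] := kappa_max kappa_reg ck' i0k.
  exists j => _; split=> // x xB xk; apply: (ordinal_in ok jk).1 cj _ _.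
  exact: cP.
have gk i : i ∈ kappa -> g i ∈ kappa by case/gP.
exists (vsep kappa (fun d => [/\ limit_ordinal d, d <> vempty & forall i, i ∈ d -> g i ∈ d])).
  exact: club_closed.
move=> d /in_vsep[dk [ld d0 dg]]; have od := ld.1.
have [j jd] : exists j, j ∈ d.
  by apply: contrapT => N; apply: d0; apply: V_ext => z; split=> [zd|/in_vempty//]; case: N; exists z.
have i0d : i0 ∈ d by have [_ ij _] := gP _ (ok.1 _ dk _ jd); apply: od.1 (dg _ jd) _ ij.
have BdE x : x ∈ Bs d <-> exists2 i, i ∈ d & x ∈ Bs i by rewrite Blim.
have kB x : (x ∈ Bs d /\ x ∈ kappa) <-> x ∈ d.
  split=> [[/BdE[i id xi] xk]|xd].
    have [_ _ /(_ x xi xk)] := gP _ (ok.1 _ dk _ id); exact: od.1 (dg _ id) _.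
  by split; [apply: (proj1 (Bsz d dk))|apply: ok.1 xd].
have [d' dk' [pi [pim pii piG]]] := Bcol d dk.
have pid i : i ∈ d -> pi i = i.
  elim/V_ind: i => i IH id; rewrite pim; last by apply: (proj1 (Bsz d dk)).
  apply: V_ext => x; split=> [/in_vimg[y /in_vI[yi _] ->]|xi].
    by rewrite IH //; apply: od.1 id _ yi.
  apply/in_vimg; exists x; last by rewrite IH //; apply: od.1 id _ xi.
  by apply/in_vI; split=> //; apply: (proj1 (Bsz d dk)); apply: od.1 id _ xi.
have dM : d `<=` M d'.
  by move=> i id; rewrite -pii; apply/in_vimg; exists i; [apply: (proj1 (Bsz d dk))|rewrite pid].
(* Reflection of the injection [s] puts [s x] into the hull whenever [x] is there, so [s] maps the
   hull into its trace [d]. *)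
have Md : M d' #<= d.
  have Bd : Bs d #<= d.
    apply: (@card_leI _ _ _ s) => [x xB|x y xB yB]; last by apply: sinj; apply: Bsub yB || apply: Bsub xB.
    have [|z zB zE] := Brefl d 0 dk x x xB xB.
      exists (s x) => //; apply: (sub_M nfM gamma_in); apply: og.1 kappa_gamma _ _.
      by apply: sk; apply: Bsub xB.
    by apply/kB; rewrite -zE; split=> //; rewrite zE; apply: sk; apply: Bsub xB.
  apply: card_le_trans Bd; apply: (@card_le_surj _ _ _ pi) => x.
  by rewrite -pii => /in_vimg[y yB ->]; exists y.
(* [d'] is contained in [M d'], whose size is at most that of [d]. *)
have d'k : d' ∈ kappa.
  apply: (card_lt_elem ck (ordinal_in (ord_kappa' _) dk')).
  apply: card_le_lt_trans (card_elem ck dk); apply: card_le_trans Md.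
  by apply: subset_card_le; apply: (sub_M nfM dk').
exists d', (Bs d), pi; split; last 2 first.
- by apply/BdE; exists i0.
- by move=> t; apply: (Brefl d t.+1 dk).
split=> //.
- exact: Bsub.
- by apply: card_eqI Md _; apply: subset_card_le.
move=> xi xid.
have : opair xi (M xi) ∈ vfun d' M by apply/in_vfun; exists xi.
rewrite -[X in X _]/(elts (vfun d' M)) -piG => -[x [y [xB yB xy /opair_inj[-> ->]]]].
case/in_vfun: xy => z /in_vsep[_ oz] /opair_inj[xz yz]; subst z y.
by exists x.
Qed.

End Hull.

(** * Codes and the reflected relations *)

Definition mrec (G : V -> (V -> V) -> V) : V -> V := projT1 (cid (mem_rec G)).

Lemma mrecE G z :
  mrec G z = G z (fun u => if `[< u ∈ z >] then mrec G u else vempty).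
Proof. exact: (projT2 (cid (mem_rec G))). Qed.

(** Evaluation of finite codes. As the codes form a countable type, all primitive recursive
    functions can be reflected at once. Arguments are lists, so that arities need not be tracked;
    malformed codes have the value [vempty]. *)
Fixpoint preval (t : code) (s : seq V) : V :=
  match t with
  | GenTree.Leaf i => nth vempty s i
  | GenTree.Node 1 [:: f; g] => vU (preval f s) (vpair (preval g s) (preval g s))
  | GenTree.Node 2 [:: f; g; p; q] =>
      if `[< preval p s ∈ preval q s >] then preval f s else preval g s
  | GenTree.Node 3 (g :: fs) => preval g (map (fun f => preval f s) fs)
  | GenTree.Node 4 [:: g] =>
      mrec (fun z R => preval g [:: vUnion (vimg R z), z & behead s]) (head vempty s)
  | _ => vempty
  end.

Lemma pr_code n (F : n.-tuple V -> V) : pr_function F ->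
  exists t, forall x, F x = preval t x.
Proof.
elim=> {n F}.
- by move=> n i; exists (GenTree.Leaf (i : nat)) => x /=; rewrite (tnth_nth vempty).
- by move=> n; exists (GenTree.Node 0 [::]).
- move=> n F G _ [f fE] _ [g gE]; exists (GenTree.Node 1 [:: f; g]) => x /=.
  by rewrite fE gE.
- move=> n F G P Q _ [f fE] _ [g gE] _ [p pE] _ [q qE].
  by exists (GenTree.Node 2 [:: f; g; p; q]) => x /=; rewrite fE gE pE qE.
- move=> m n G F _ [g gE] _ /choice[f fE].
  exists (GenTree.Node 3 (g :: map f (enum 'I_m))) => x /=; rewrite gE; congr preval.
  by rewrite -map_comp /=; apply: eq_map => i /=; rewrite fE.
- move=> n G F _ [g gE] FE; exists (GenTree.Node 4 [:: g]) => x.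
  case/tupleP: x => z x; elim/V_ind: z => z IH /=.
  rewrite FE gE mrecE /=; congr (preval g [:: vUnion _, z & _]).
  apply: V_ext => y; split=> /in_vimg[u uz ->]; apply/in_vimg; exists u => //.
    by rewrite asboolT // (IH u uz).
  by rewrite asboolT // (IH u uz).
Qed.

(** The code records neither the arities of the language nor the number [n] of free variables;
    [R_sat] supplies them separately. *)
Fixpoint fcode (L : language) (sc : symbol L -> nat) n (f : fml L n) : code :=
  match f with
  | Eq i j => GenTree.Node 0 [:: GenTree.Leaf (i : nat); GenTree.Leaf (j : nat)]
  | Rel r v => GenTree.Node 1 (GenTree.Leaf (sc r) :: map (fun i : 'I_n => GenTree.Leaf (i : nat)) v)
  | Bot => GenTree.Node 2 [::]
  | Imp g h => GenTree.Node 3 [:: fcode sc g; fcode sc h]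
  | All g => GenTree.Node 4 [:: fcode sc g]
  end.

Lemma fcode_inj L (sc : symbol L -> nat) n : injective sc -> injective (@fcode L sc n).
Proof.
move=> scI f; elim: f => {n}.
- by move=> n i j [] //= i' j' [/ord_inj -> /ord_inj ->].
- move=> n r v [] //= r' v' [/scI rr]; subst r'.
  by move/inj_map => vv; congr Rel; apply: val_inj; apply: vv => i j [/ord_inj].
- by move=> n [].
- by move=> n g IHg h IHh [] //= g' h' [/IHg -> /IHh ->].
- by move=> n g IHg [] //= g' [/IHg ->].
Qed.

Definition pi12_code mX mY mA (r : symbol (pi12_language mX mY mA)) : nat :=
  match r with pi12_mem => 0 | pi12_X => 1 | pi12_Y => 2 | pi12_A n => n.+3 end.

Lemma pi12_code_inj mX mY mA : injective (@pi12_code mX mY mA).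
Proof. by move=> [|||n] [|||m] //= [->]. Qed.

Definition arcode (m : nat -> nat) : V := vseq (fun n => vnat (m n)).

Lemma arcode_inj : injective arcode.
Proof.
move=> m m' /vseq_inj E; apply/funext => n.
by apply: vnat_inj; apply: (congr1 (fun f => f n) E).
Qed.

Definition scode (phi : pi12_sentence) : code :=
  GenTree.Node 0 [:: GenTree.Leaf (mX phi); GenTree.Leaf (mY phi);
    fcode (@pi12_code _ _ _) (matrix phi)].

Lemma scode_inj phi psi : mA phi = mA psi -> scode phi = scode psi -> phi = psi.
Proof.
case: phi psi => x y m f [x' y' m' f'] /= E; subst m' => -[E1 E2]; subst x' y'.
by move/(fcode_inj (@pi12_code_inj _ _ _)) ->.
Qed.

Lemma pr_closed_vpair N x y : pr_closed N -> N x -> N y -> N (vpair x y).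
Proof.
move=> prN Nx Ny.
pose F (e : 2.-tuple V) := vU (vU vempty (vpair (tnth e ord0) (tnth e ord0)))
  (vpair (tnth e ord_max) (tnth e ord_max)).
have prF : pr_function F by do !apply: pr_adjoin; try exact: pr_proj; exact: pr_empty.
have := prN _ F prF [tuple x; y]; rewrite /F !(tnth_nth vempty) /=.
suff -> : vU (vU vempty (vpair x x)) (vpair y y) = vpair x y.
  by apply => -[[|[|//]] ilt]; rewrite (tnth_nth vempty).
apply: V_ext => z; rewrite !in_vU !in_vpair.
by split=> [[[/in_vempty//|[]]|[]]|[]]; auto.
Qed.

Lemma pr_closed_opair N x y : pr_closed N -> N x -> N y -> N (opair x y).
Proof. by move=> prN Nx Ny; do !apply: pr_closed_vpair. Qed.

(** [delta] is a nonzero limit point of [D]. *)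
Definition unb (D delta : V) : Prop :=
  delta <> vempty /\ forall i, i ∈ delta -> exists d, [/\ d ∈ D, d ∈ delta & i ∈ d].

Definition restr (A : nat -> V) (m : nat -> nat) (delta : V) : nat -> V :=
  fun n => vI (A n) (vexp delta (m n)).

Definition good (N : V -> V) (phi : pi12_sentence) (A : nat -> V) (delta : V) : Prop :=
  (N delta #= delta) /\
  pi12_models_in (N delta) delta (restr A (mA phi) delta) phi.

(** [N] is consulted only below [alpha], which permits defining [N] by recursion on badness.
    [bad_code] places the arity function in [M xi], so that it has a preimage when [M xi] is pulled
    back to a hull. *)
Record bad (M N : V -> V) (S alpha xi : V) (phi : pi12_sentence) (A : nat -> V) (D : V) : Prop := {
  bad_sees : sees (M xi) alpha;
  bad_code : arcode (mA phi) ∈ M xi;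
  bad_D : D ∈ M xi;
  bad_Dsub : D `<=` alpha;
  bad_unb : unb D alpha;
  bad_A : forall n, A n `<=` vexp alpha (mA phi n);
  bad_models : pi12_models_in (M xi) alpha A phi;
  bad_good : forall delta, delta ∈ alpha -> delta ∈ S -> unb D delta -> ~ good N phi A delta
}.

Section Relations.
Variables (kappa S : V) (N : V -> V).

(** Reflecting the following relations is all that is used of elementarity.  They are indexed by
    countable data; the arity function of a sentence ranges over an uncountable set and therefore is
    a parameter, through its code [arcode]. *)
Definition relation := seq nat -> code -> V -> V -> V -> Prop.

Definition R_pair : relation := fun _ _ x y z => z = vpair x y.
(** This and many of the following relations say that [z] is a counterexample: if a universal
    statement with parameters in [B] fails, then it fails for an element of [B]. *)
Definition R_diff : relation := fun _ _ x y z => z ∈ x /\ ~ z ∈ y.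
Definition R_fst : relation := fun _ _ x y z => exists w, x = opair z w.
Definition R_snd : relation := fun _ _ x y z => exists w, x = opair w z.
Definition R_kappa : relation := fun _ _ x y z => z = kappa.
Definition R_notexp : relation :=
  fun l _ x y z => z ∈ x /\ ~ z ∈ vexp kappa (head 0 l).
Definition R_notnat2 : relation := fun _ _ x y z => z ∈ x /\ ~ z ∈ vprod omega omega.
Definition R_app : relation := fun _ _ x y z => opair y z ∈ x.
Definition R_notseq : relation :=
  fun _ _ x y z => z ∈ x /\ ~ exists n v, z = opair (vnat n) v.
Definition R_app_neq : relation :=
  fun l _ x y z => exists v, [/\ z = opair (vnat (head 0 l)) v, z ∈ x & v <> y].
Definition R_pr : relation :=
  fun l t x y z => exists s, [/\ size s = head 0 l, x = ntuple s & z = preval t s].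
Definition R_pr_rec : relation :=
  fun l t x y z => exists u s, [/\ size s = head 0 l, x = ntuple (u :: s), z ∈ u &
    y ∈ preval t (z :: s)].
Definition R_not_pr : relation :=
  fun l t x y z => exists s, [/\ size s = head 0 l, z = ntuple s,
    {in s, forall u, u ∈ x} & ~ preval t s ∈ x].
Definition R_sat : relation := fun l t x y z =>
  exists mX mY mA n (f : fml (pi12_language mX mY mA) n.+1) X Y A (e : n.-tuple V),
    [/\ l = [:: mX; mY; n] /\ t = fcode (@pi12_code _ _ _) f,
        x = opair (opair X Y) (vseq A), y = opair (arcode mA) (ntuple e),
        z ∈ kappa & ~ sat (pi12_structure mX mY mA kappa X Y A) f [tuple of z :: e]].
Definition pi12_witness phi (X : V) (A : nat -> V) (Y : V) : Prop :=
  Y `<=` vexp kappa (mY phi) /\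
  sat (pi12_structure (mX phi) (mY phi) (mA phi) kappa X Y A) (matrix phi) [tuple].
Definition R_witness : relation := fun _ t x y z => exists phi X A,
  [/\ t = scode phi, x = opair X (vseq A), y = arcode (mA phi) &
      pi12_witness phi X A z].
Definition R_cex : relation := fun _ t x y z => exists phi A,
  [/\ t = scode phi, x = opair (vseq A) (arcode (mA phi)), z ∈ y,
      z `<=` vexp kappa (mX phi) &
      forall Y, Y ∈ y -> ~ pi12_witness phi z A Y].
Definition R_good : relation := fun _ t x y z => exists phi A,
  [/\ t = scode phi, x = opair (vseq A) (arcode (mA phi)), z ∈ kappa /\ z ∈ S,
      unb y z & good N phi A z].
Definition R_above : relation := fun _ _ x y z => z ∈ x /\ y ∈ z.
Definition R_not_below : relation :=
  fun _ _ x y z => z ∈ kappa /\ ~ exists d, [/\ d ∈ x, d ∈ kappa & z ∈ d].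
Definition R_not_total : relation :=
  fun _ _ x y z => z ∈ kappa /\ ~ exists2 v, v ∈ y & opair z v ∈ x.
Definition R_not_inj : relation := fun _ _ x y z => exists u u' v,
  [/\ z = ntuple [:: u; u'; v], [/\ u ∈ kappa, u' ∈ kappa & v ∈ y], u <> u',
      opair u v ∈ x & opair u' v ∈ x].

(** Applications of reflection refer to a relation by its position in this list, counted from 0. *)
Definition relations : seq relation := [:: R_pair; R_diff; R_fst; R_snd; R_kappa;
  R_notexp; R_notnat2; R_app; R_notseq; R_app_neq; R_pr; R_pr_rec; R_not_pr; R_sat;
  R_witness; R_cex; R_good; R_above; R_not_below; R_not_total; R_not_inj].

Definition relation_nat (n : nat) : V -> V -> V -> Prop :=
  if unpickle n is Some (i, l, t) then
    nth (fun _ _ _ _ _ => False) relations i (l : seq nat) (t : code)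
  else fun _ _ _ => False.

Definition reflects_all (B D : set V) : Prop :=
  forall i, (i < size relations)%N -> forall l t,
    reflects B D (nth (fun _ _ _ _ _ => False) relations i l t).

Lemma reflects_relation_nat B D : (forall n, reflects B D (relation_nat n)) ->
  reflects_all B D.
Proof. by move=> BD i _ l t; have := BD (pickle (i, l, t)); rewrite /relation_nat pickleK. Qed.

End Relations.

(** * Transfer between a hull and its collapse *)

(** The members of [x] and of their transitive closures form a transitive class including [x]. If
    [x] were in it, some [w] in [x] would be equal to [x] or belong to its own transitive
    closure. *)
Lemma trcl_irr (x : V) : ~ trcl x x.
Proof.
elim/V_ind: x => x IH xx.
have [|y yx|w wx [wE|xw]] := xx [set y | exists2 w, w ∈ x & y = w \/ trcl w y].
- move=> y [w wx yw] z zy; exists w => //; right; case: yw => [yE|wy].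
    by apply: trcl_sub; rewrite -yE.
  exact: (trcl_transitive wy zy).
- by exists y => //; left.
- by move: wx; rewrite -wE => /mem_irr.
- by apply: (IH w wx); exact: (trcl_transitive xw wx).
Qed.

Lemma pr_nth n k : pr_function (fun x : n.-tuple V => nth vempty x k).
Proof.
have [kn|nk] := ltnP k n.
  have -> : (fun x : n.-tuple V => nth vempty x k) = (fun x => tnth x (Ordinal kn)).
    by apply/funext => x; rewrite (tnth_nth vempty).
  exact: pr_proj.
have -> : (fun x : n.-tuple V => nth vempty x k) = (fun=> vempty).
  by apply/funext => x; rewrite nth_default ?size_tuple.
exact: pr_empty.
Qed.

(** The recursion for [F] is stopped at [z], which is passed as the parameter [{z}]: it then returns
    the union itself. *)
Lemma pr_rec_union n (G : n.+2.-tuple V -> V) (F : n.+1.-tuple V -> V) :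
  pr_function G ->
  (forall z (x : n.-tuple V), F [tuple of z :: x] =
    G [tuple of vUnion (vimg (fun u => F [tuple of u :: x]) z) :: z :: x]) ->
  exists2 K : n.+1.-tuple V -> V, pr_function K & forall z (x : n.-tuple V),
    K [tuple of z :: x] = vUnion (vimg (fun u => F [tuple of u :: x]) z).
Proof.
move=> prG FE.
(* [g] skips position 2, which holds the stopping parameter. *)
pose g (i : 'I_n.+2) (t : n.+3.-tuple V) := nth vempty t (if (i < 2)%N then i : nat else i.+1).
pose G' (t : n.+3.-tuple V) :=
  if `[< nth vempty t 1 ∈ nth vempty t 2 >] then nth vempty t 0
  else G [tuple g i t | i < n.+2].
have prG' : pr_function G'.
  apply: pr_if; try exact: pr_nth.
  by apply: pr_comp => // i; exact: pr_nth.
pose F' (t : n.+2.-tuple V) :=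
  mrec (fun z R => G' [tuple of vUnion (vimg R z) :: z :: behead t]) (thead t).
have F'E z (x : n.+1.-tuple V) : F' [tuple of z :: x] =
    G' [tuple of vUnion (vimg (fun u => F' [tuple of u :: x]) z) :: z :: x].
  rewrite /F' mrecE theadE; congr G'; apply: val_inj => /=; congr [:: vUnion _, _ & _].
  apply: V_ext => y; split=> /in_vimg[u uz ->]; apply/in_vimg; exists u => //.
    by rewrite asboolT // theadE.
  by rewrite asboolT // theadE.
have prF' : pr_function F' by apply: pr_rec prG' F'E.
(* [k] inserts the singleton of the first argument at position 1. *)
pose k (i : 'I_n.+2) (t : n.+1.-tuple V) := match (i : nat) with
  | 0 => nth vempty t 0
  | 1 => vU vempty (vpair (nth vempty t 0) (nth vempty t 0))
  | j.+2 => nth vempty t j.+1 end.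
have prk i : pr_function (k i).
  case: i => [[|[|j]] ilt]; rewrite /k; try exact: pr_nth.
  by apply: pr_adjoin; [exact: pr_empty|exact: pr_nth].
exists (fun t => F' [tuple k i t | i < n.+2]); first exact: pr_comp.
move=> z x.
have -> : [tuple k i [tuple of z :: x] | i < n.+2] = [tuple of z :: vU vempty (vpair z z) :: x].
  apply: eq_from_tnth => i; rewrite tnth_mktuple (tnth_nth vempty) /k.
  by case: i => [[|[|j]] ilt].
set s := vU _ _.
have sE u : u ∈ s <-> u = z by rewrite in_vU in_vpair; split=> [[/in_vempty//|[]]|]; auto.
(* The stop is not triggered strictly below [z], since [z] is not in its own transitive closure. *)
have F'F u : trcl z u -> F' [tuple of u :: s :: x] = F [tuple of u :: x].
  elim/V_ind: u => u IH zu; rewrite F'E /G' /= asboolF; last first.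
    by move/sE => E; apply: (@trcl_irr z); rewrite -{2}E.
  rewrite FE; congr G; apply: eq_from_tnth => i; rewrite tnth_mktuple (tnth_nth vempty) /g.
  case: i => [[|[|j]] ilt] //=; congr vUnion; apply: V_ext => y.
  split=> /in_vimg[v vu ->]; apply/in_vimg; exists v => //.
    by rewrite IH //; exact: (trcl_transitive zu vu).
  by rewrite IH //; exact: (trcl_transitive zu vu).
rewrite F'E /G' /= asboolT; last exact/sE.
congr vUnion; apply: V_ext => y.
split=> /in_vimg[v vu ->]; apply/in_vimg; exists v => //.
  by rewrite F'F //; exact: trcl_sub.
by rewrite F'F //; exact: trcl_sub.
Qed.

(** [e] may be multivalued; any choice of values in [nu] is injective. Each of the two clauses is
    refuted by a single counterexample, which makes them easy to reflect. *)
Definition inj_graph (e alpha nu : V) : Prop :=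
  (forall x, x ∈ alpha -> exists2 y, y ∈ nu & opair x y ∈ e) /\
  (forall x x' y, x ∈ alpha -> x' ∈ alpha -> y ∈ nu ->
     opair x y ∈ e -> opair x' y ∈ e -> x = x').

Section HullTransfer.
Variables (kappa S : V) (N M : V -> V) (gamma delta delta' B : V) (pi : V -> V).
Hypothesis hB : hull kappa M gamma delta delta' B pi.
Hypothesis tr_gamma : transitive_set (M gamma).
Hypothesis pr_gamma : pr_closed (M gamma).
Hypothesis kappa_gamma : kappa ∈ M gamma.
Hypothesis rB : reflects_all kappa S N B (M gamma).

Let Bg := hull_sub hB.
Let od : ordinal delta := (hull_limit hB).1.

Let rB' i (lt_i : (i < size (relations kappa S N))%N) l t x y z :
  x ∈ B -> y ∈ B -> z ∈ M gamma ->
  nth (fun _ _ _ _ _ => False) (relations kappa S N) i l t x y z ->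
  exists2 z, z ∈ B & nth (fun _ _ _ _ _ => False) (relations kappa S N) i l t x y z.
Proof. by move=> xB yB zg Rz; apply: rB => //; exists z. Qed.

Let nc : code := GenTree.Leaf 0.

Lemma hull_vpair x y : x ∈ B -> y ∈ B -> vpair x y ∈ B.
Proof.
move=> xB yB; have zg : vpair x y ∈ M gamma by apply: pr_closed_vpair => //; apply: Bg.
by have [z zB <-] := @rB' 0 isT [::] nc _ _ _ xB yB zg erefl.
Qed.

Lemma hull_opair x y : x ∈ B -> y ∈ B -> opair x y ∈ B.
Proof. by move=> xB yB; do !apply: hull_vpair. Qed.

Lemma opair_gamma x y : opair x y ∈ M gamma -> x ∈ M gamma /\ y ∈ M gamma.
Proof.
move=> pg; have pxy : vpair x y ∈ opair x y by apply/in_vpair; right.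
have xyg := tr_gamma pg pxy.
by split; apply: (tr_gamma xyg); apply/in_vpair; [left|right].
Qed.

Lemma hull_fst x y : opair x y ∈ B -> x ∈ B.
Proof.
move=> pB; have [xg yg] := opair_gamma (Bg pB).
have [z zB [w /opair_inj[-> _]]//] := @rB' 2 isT [::] nc _ _ _ pB pB xg (ex_intro _ y erefl).
Qed.

Lemma hull_snd x y : opair x y ∈ B -> y ∈ B.
Proof.
move=> pB; have [xg yg] := opair_gamma (Bg pB).
have [z zB [w /opair_inj[_ ->]]//] := @rB' 3 isT [::] nc _ _ _ pB pB yg (ex_intro _ x erefl).
Qed.

Lemma delta_hull i : i ∈ delta -> i ∈ B.
Proof. by move/(hull_kappa hB) => -[]. Qed.

Lemma delta_kappa : delta `<=` kappa.
Proof. by move=> i /(hull_kappa hB)[]. Qed.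

Lemma in_delta i : i ∈ B -> i ∈ kappa -> i ∈ delta.
Proof. by move=> iB ik; apply/(hull_kappa hB). Qed.

Lemma delta_vnat n : vnat n ∈ delta.
Proof.
have [_ dS] := hull_limit hB; elim: n => [|n /dS//].
apply: contrapT => N0; apply: (hull_delta0 hB).
by have := ordinal_notin (ordinal_vnat 0) od N0; move=> sub; apply: V_ext => z;
  split=> [/sub//|/in_vempty].
Qed.

Lemma kappa_hull : kappa ∈ B.
Proof.
have wB := delta_hull (delta_vnat 0).
by have [z zB <-] := @rB' 4 isT [::] nc _ _ _ wB wB kappa_gamma erefl.
Qed.

Lemma hull_diff x y : x ∈ B -> y ∈ B -> ~ x `<=` y -> exists z, [/\ z ∈ B, z ∈ x & ~ z ∈ y].
Proof.
move=> xB yB xy; have [z zx zy] : exists2 z, z ∈ x & ~ z ∈ y.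
  by apply: contrapT => zN; apply: xy => z zx; apply: contrapT => zy; apply: zN; exists z.
have zg := tr_gamma (Bg xB) zx.
by have [t tB [tx ty]] := @rB' 1 isT [::] nc _ _ _ xB yB zg (conj zx zy); exists t.
Qed.

Lemma in_pi x z : x ∈ B -> z ∈ pi x <-> exists y, [/\ y ∈ B, y ∈ x & z = pi y].
Proof.
move=> xB; rewrite (hull_mostowski hB) // in_vimg.
by split=> [[y /in_vI[yx yB] ->]|[y [yB yx ->]]]; exists y => //; apply/in_vI.
Qed.

(** [hull_diff] makes [B] extensional, so the collapse is injective by induction on membership. *)
Lemma pi_inj x y : x ∈ B -> y ∈ B -> pi x = pi y -> x = y.
Proof.
elim/V_ind: x y => x IH y xB yB E.
have xy : x `<=` y.
  apply: contrapT => /(hull_diff xB yB)[z [zB zx zy]].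
  have : pi z ∈ pi y by rewrite -E; apply/in_pi => //; exists z.
  by case/in_pi=> // w [wB wy /(IH _ zx _ zB wB) zw]; apply: zy; rewrite zw.
have yx : y `<=` x.
  apply: contrapT => /(hull_diff yB xB)[z [zB zy zx]].
  have : pi z ∈ pi x by rewrite E; apply/in_pi => //; exists z.
  by case/in_pi=> // w [wB wx /esym/(IH _ wx _ wB zB) wz]; apply: zx; rewrite -wz.
by apply: V_ext => z; split=> [/xy|/yx].
Qed.

Lemma pi_mem x y : x ∈ B -> y ∈ B -> pi x ∈ pi y <-> x ∈ y.
Proof.
move=> xB yB; rewrite in_pi //; split=> [[z [zB zy /(pi_inj xB zB) ->]]//|xy].
by exists x.
Qed.

Lemma in_collapse z : z ∈ M delta' <-> exists2 x, x ∈ B & z = pi x.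
Proof. by rewrite -(hull_img hB) in_vimg. Qed.

Lemma pi_collapse x : x ∈ B -> pi x ∈ M delta'.
Proof. by move=> xB; apply/in_collapse; exists x. Qed.

Lemma pi_vpair x y : x ∈ B -> y ∈ B -> pi (vpair x y) = vpair (pi x) (pi y).
Proof.
move=> xB yB; apply: V_ext => z; rewrite in_pi ?in_vpair; last exact: hull_vpair.
split=> [[t [_ /in_vpair[]-> ->]]|[]->]; [by left|by right| |].
  by exists x; split=> //; apply/in_vpair; left.
by exists y; split=> //; apply/in_vpair; right.
Qed.

Lemma pi_opair x y : x ∈ B -> y ∈ B -> pi (opair x y) = opair (pi x) (pi y).
Proof. by move=> xB yB; rewrite !pi_vpair //; apply: hull_vpair. Qed.

Lemma pi_delta i : i ∈ delta -> pi i = i.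
Proof.
elim/V_ind: i => i IH id; apply: V_ext => z; rewrite in_pi; last exact: delta_hull.
split=> [[t [_ ti ->]]|zi]; first by rewrite IH //; apply: od.1 id _ ti.
have zd := od.1 _ id _ zi.
by exists z; split; [exact: delta_hull|by []|rewrite IH].
Qed.

Lemma pi_kappa : pi kappa = delta.
Proof.
apply: V_ext => z; rewrite in_pi; last exact: kappa_hull.
split=> [[t [tB tk ->]]|zd]; first by have td := in_delta tB tk; rewrite pi_delta.
by exists z; split; [exact: delta_hull|exact: delta_kappa|rewrite pi_delta].
Qed.

Lemma hull_ntuple s : {in s, forall x, x ∈ B} -> ntuple s ∈ B.
Proof.
elim/last_ind: s => [_|s x IH sB]; first exact: (delta_hull (delta_vnat 0)).
have [->|sN] := eqVneq s [::].
  by rewrite /=; apply: sB; rewrite mem_rcons inE eqxx.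
rewrite ntuple_rcons //; apply: hull_opair; last by apply: sB; rewrite mem_rcons inE eqxx.
by apply: IH => y ys; apply: sB; rewrite mem_rcons inE ys orbT.
Qed.

Lemma hull_ntupleE s : ntuple s ∈ B -> {in s, forall x, x ∈ B}.
Proof.
elim/last_ind: s => [//|s x IH]; have [->|sN] := eqVneq s [::].
  by move=> /= xB y; rewrite inE => /eqP ->.
rewrite ntuple_rcons // => pB y; rewrite mem_rcons inE => /orP[/eqP ->|].
  exact: hull_snd pB.
exact: IH (hull_fst pB) y.
Qed.

Lemma pi_ntuple s : {in s, forall x, x ∈ B} -> pi (ntuple s) = ntuple (map pi s).
Proof.
elim/last_ind: s => [_|s x IH sB]; first exact: pi_delta (delta_vnat 0).
have [->|sN] := eqVneq s [::]; first by [].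
have xB : x ∈ B by apply: sB; rewrite mem_rcons inE eqxx.
have {}sB : {in s, forall x, x ∈ B} by move=> y ys; apply: sB; rewrite mem_rcons inE ys orbT.
rewrite map_rcons !ntuple_rcons ?pi_opair ?IH //; first exact: hull_ntuple.
by case: (s) sN.
Qed.

Lemma vexp_delta m z : z ∈ vexp delta m -> z ∈ B /\ pi z = z.
Proof.
case/in_vexp => s [_ sd ->].
have sB : {in s, forall x, x ∈ B} by move=> x /sd/delta_hull.
split; first exact: hull_ntuple.
rewrite pi_ntuple //; congr ntuple; rewrite -[RHS]map_id; apply/eq_in_map => x /sd.
exact: pi_delta.
Qed.

Lemma vexp_kappa m z : z ∈ B -> z ∈ vexp kappa m -> z ∈ vexp delta m.
Proof.
move=> zB /in_vexp[s [sm sk zE]]; apply/in_vexp; exists s; split=> // x xs.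
by apply: in_delta; [apply: hull_ntupleE xs; rewrite -zE|apply: sk].
Qed.

Lemma pi_subset m X : X ∈ B -> X `<=` vexp kappa m -> pi X = vI X (vexp delta m).
Proof.
move=> XB Xk; apply: V_ext => z; rewrite in_pi // in_vI; split=> [[t [tB tX ->]]|[zX zd]].
  by have td := vexp_kappa tB (Xk _ tX); have [_ ->] := vexp_delta td.
by have [zB zE] := vexp_delta zd; exists z.
Qed.

(** An element of [X] outside the power of [kappa] could be found in [B]; its collapse is a tuple
    from [delta], hence fixed by [pi], so it is that element itself. *)
Lemma pi_subsetV m X : X ∈ B -> pi X `<=` vexp delta m -> X `<=` vexp kappa m.
Proof.
move=> XB Xd z zX; apply: contrapT => zN.
have zg := tr_gamma (Bg XB) zX.
have [t tB [tX tN]] := @rB' 5 isT [:: m] nc _ _ _ XB XB zg (conj zX zN).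
have td : pi t ∈ vexp delta m by apply: Xd; apply/pi_mem.
have [ptB ptE] := vexp_delta td.
apply: tN; rewrite /= -(pi_inj ptB tB ptE).
exact: vexp_sub delta_kappa _ td.
Qed.

Lemma omega2_hull z : z ∈ vprod omega omega -> z ∈ B /\ pi z = z.
Proof.
case/in_vprod => _ [_ [/in_omega[n ->] /in_omega[m ->] ->]].
have nd := delta_vnat n; have md := delta_vnat m.
by split; [apply: hull_opair; exact: delta_hull|rewrite pi_opair ?pi_delta //; exact: delta_hull].
Qed.

Lemma arcode_sub m : arcode m `<=` vprod omega omega.
Proof.
move=> _ /in_vseq[n ->]; apply/in_vprod; exists (vnat n), (vnat (m n)).
by split=> //; exact: vnat_omega.
Qed.

Lemma pi_omega2 c : c ∈ B -> c `<=` vprod omega omega -> pi c = c.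
Proof.
move=> cB cw; apply: V_ext => z; rewrite in_pi //; split=> [[t [tB tc ->]]|zc].
  by have [_ ->] := omega2_hull (cw _ tc).
by have [zB zE] := omega2_hull (cw _ zc); exists z.
Qed.

Lemma pi_arcode m : arcode m ∈ B -> pi (arcode m) = arcode m.
Proof. by move=> mB; apply: pi_omega2 => //; exact: arcode_sub. Qed.

Lemma pi_arcodeV c m : c ∈ B -> pi c = arcode m -> c = arcode m.
Proof.
move=> cB cm; rewrite -cm pi_omega2 // => z zc; apply: contrapT => zN.
have zg := tr_gamma (Bg cB) zc.
have [t tB [tc tN]] := @rB' 6 isT [::] nc _ _ _ cB cB zg (conj zc zN).
have tw : pi t ∈ vprod omega omega by apply: (@arcode_sub m); rewrite -cm; apply/pi_mem.
have [ptB ptE] := omega2_hull tw.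
by apply: tN; rewrite /= -(pi_inj ptB tB ptE).
Qed.

Lemma vseq_hull A n : vseq A ∈ B -> A n ∈ B.
Proof.
move=> AB; have nB := delta_hull (delta_vnat n).
have nA : opair (vnat n) (A n) ∈ vseq A by apply/in_vseq; exists n.
have [_ Ag] := opair_gamma (tr_gamma (Bg AB) nA).
have [z zB /= /in_vseq[k /opair_inj[/vnat_inj <- <-]]//] := @rB' 7 isT [::] nc _ _ _ AB nB Ag nA.
Qed.

Lemma pi_vseq A m : vseq A ∈ B -> (forall n, A n `<=` vexp kappa (m n)) ->
  pi (vseq A) = vseq (restr A m delta).
Proof.
move=> AB Ak; apply: V_ext => z; rewrite in_pi // in_vseq.
have E n : pi (opair (vnat n) (A n)) = opair (vnat n) (restr A m delta n).
  rewrite pi_opair ?(pi_delta (delta_vnat n)) ?(@pi_subset (m n)) //.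
  - exact: vseq_hull.
  - exact: (delta_hull (delta_vnat n)).
  - exact: vseq_hull.
split=> [[t [tB /in_vseq[n ->] ->]]|[n ->]]; first by exists n; rewrite E.
exists (opair (vnat n) (A n)); split=> //; last by apply/in_vseq; exists n.
by apply: hull_opair; [exact: (delta_hull (delta_vnat n))|exact: vseq_hull].
Qed.

(** Preimages [A n] of the components are chosen in [B]. Any further member of [a] would reflect
    into [B], where [npair] excludes it. *)
Lemma pi_vseqV a A' m : a ∈ B -> pi a = vseq A' -> (forall n, A' n `<=` vexp delta (m n)) ->
  exists A, [/\ a = vseq A, forall n, A n `<=` vexp kappa (m n) & A' = restr A m delta].
Proof.
move=> aB aE A'd.
have H n : exists v, [/\ v ∈ B, pi v = A' n & opair (vnat n) v ∈ a].
  have : opair (vnat n) (A' n) ∈ pi a by rewrite aE; apply/in_vseq; exists n.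
  case/in_pi=> // t [tB ta tE].
  (* [A' n] is reached from the pair by descending twice, each time to the collapse of an element of
     [B]. *)
  have A'c : A' n ∈ M delta'.
    have tc := pi_collapse tB; rewrite -tE in tc.
    have /in_collapse[u uB uE] := tc.
    have td : pi t = pi u by rewrite -tE.
    have := pi_inj tB uB td => {}td; subst u.
    have [v [vB vt vE]] : exists v, [/\ v ∈ B, v ∈ t & pi v = vpair (vnat n) (A' n)].
      have : vpair (vnat n) (A' n) ∈ pi t by rewrite -tE; apply/in_vpair; right.
      by case/in_pi=> // v [vB vt ->]; exists v.
    have : A' n ∈ pi v by rewrite vE; apply/in_vpair; right.
    by case/in_pi=> // w [wB _ ->]; exact: pi_collapse.
  have /in_collapse[v vB vE] := A'c; exists v; split=> //.
  have nB := delta_hull (delta_vnat n).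
  suff -> : opair (vnat n) v = t by [].
  apply: pi_inj => //; first exact: hull_opair.
  by rewrite pi_opair // (pi_delta (delta_vnat n)) -tE vE.
have /choice[A AP] := H; exists A.
have Ak n : A n `<=` vexp kappa (m n).
  by have [vB vE _] := AP n; apply: pi_subsetV => //; rewrite vE.
split=> //; last first.
  by apply/funext => n; have [vB vE _] := AP n; rewrite /restr -(pi_subset vB (Ak n)).
have npair t : t ∈ B -> t ∈ a -> exists n, t = opair (vnat n) (A n).
  move=> tB ta; have : pi t ∈ pi a by apply/pi_mem.
  rewrite aE => /in_vseq[n tE]; exists n; have [vB vE _] := AP n.
  have nB := delta_hull (delta_vnat n).
  apply: pi_inj => //; first exact: hull_opair.
  by rewrite pi_opair // (pi_delta (delta_vnat n)) vE.
apply: V_ext => z; rewrite in_vseq; split=> [za|[n ->]]; last by have [] := AP n.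
have zg := tr_gamma (Bg aB) za.
have [[n [v zE]]|zN] := pselect (exists n v, z = opair (vnat n) v); last first.
  have [t tB [ta []]] := @rB' 8 isT [::] nc _ _ _ aB aB zg (conj za zN).
  by have [n tE] := npair _ tB ta; exists n, (A n).
exists n; rewrite zE; congr opair; apply: contrapT => vN; have [AB _ _] := AP n.
have [] := @rB' 9 isT [:: n] nc _ _ _ aB AB zg; first by exists v.
move=> t tB [w [/= tE ta wA]]; apply: wA; have [k] := npair _ tB ta.
by rewrite tE => /opair_inj[/vnat_inj <-].
Qed.

(** Only the quantifier needs an argument: a counterexample in [kappa] reflects to one in [B], hence
    in [delta], the trace of [B] on [kappa]. *)
Lemma sat_pi mX mY mA (X Y : V) (A : nat -> V) n (f : fml (pi12_language mX mY mA) n)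
    (e : n.-tuple V) :
  X ∈ B -> Y ∈ B -> vseq A ∈ B -> arcode mA ∈ B ->
  (forall i, tnth e i ∈ delta) ->
  sat (pi12_structure mX mY mA kappa X Y A) f e <->
  sat (pi12_structure mX mY mA delta (vI X (vexp delta mX)) (vI Y (vexp delta mY))
         (restr A mA delta)) f e.
Proof.
move=> XB YB AB mB; elim: f e => {n} [n i j|n r v|n|n g IHg h IHh|n g IH] e ed //.
- have vd k (t : k.-tuple 'I_n) : ntuple (map_tuple (tnth e) t) ∈ vexp delta k.
    apply/in_vexp; exists (map (tnth e) t); rewrite size_map size_tuple; split=> //.
    by move=> x /mapP[i _ ->].
  case: r v => [|||k] v //=.
  + by rewrite in_vI; split=> [vX|[]//]; split=> //; apply: vd.
  + by rewrite in_vI; split=> [vY|[]//]; split=> //; apply: vd.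
  + by rewrite in_vI; split=> [vA|[]//]; split=> //; apply: vd.
- by rewrite /= IHg // IHh.
- have ed' x : x ∈ delta -> forall i, tnth [tuple of x :: e] i ∈ delta.
    by move=> xd i; case: (unliftP ord0 i) => [j|] ->; rewrite ?tnthS.
  split=> /= satg x xd; first by apply/IH; [exact: ed'|apply: satg; apply: delta_kappa].
  apply: contrapT => xN.
  have eB : ntuple e ∈ B.
    apply: hull_ntuple => y /(nthP vempty)[i]; rewrite size_tuple => ilt <-.
    by rewrite -(tnth_nth vempty e (Ordinal ilt)); apply: delta_hull.
  have xg : x ∈ M gamma by apply: tr_gamma xd.
  have [] := @rB' 13 isT [:: mX; mY; n] (fcode (@pi12_code _ _ _) g) _ _ x
    (hull_opair (hull_opair XB YB) AB) (hull_opair mB eB) xg.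
    by exists mX, mY, mA, n, g, X, Y, A, e.
  move=> z zB /= [mX' [mY' [mA' [n' [g' [X' [Y' [A' [e' [[]]]]]]]]]]].
  move=> -[E1 E2 E3]; subst mX' mY' n'.
  move=> gE /opair_inj[/opair_inj[EX EY] /vseq_inj EA] /opair_inj[/arcode_inj EmA].
  subst X' Y' A' mA'; move/(fcode_inj (@pi12_code_inj _ _ _)): gE => gE; subst g'.
  move=> /ntuple_inj; rewrite !size_tuple => /(_ erefl)/val_inj ee; subst e'.
  move=> zk; apply; have zd := in_delta zB zk.
  by apply/IH; [exact: ed'|exact: satg].
Qed.

(** Values stay in [B] because the graph of each coded function is reflected. That [pi] commutes
    with the function follows by induction on its definition, with an inner induction on membership
    for recursion. *)
Lemma pi_pr n (F : n.-tuple V -> V) : pr_function F -> forall x : n.-tuple V,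
  (forall i, tnth x i ∈ B) -> F x ∈ B /\ pi (F x) = F (map_tuple pi x).
Proof.
move=> prF.
have FB k (G : k.-tuple V -> V) (x : k.-tuple V) : pr_function G ->
    (forall i, tnth x i ∈ B) -> G x ∈ B.
  move=> prG xB; have [t tE] := pr_code prG.
  have Gg : G x ∈ M gamma by apply: pr_gamma => // i; apply: Bg.
  have xB' : {in x, forall y, y ∈ B} by move=> y /tnthP[i ->].
  have sB := hull_ntuple xB'.
  have [] := @rB' 10 isT [:: k] t _ _ _ sB sB Gg.
    by exists x; rewrite size_tuple; split.
  move=> z zB /= [s [sk xE zE]].
  have {}xE : tval x = s by apply: ntuple_inj xE; rewrite size_tuple.
  by move: zB; rewrite zE -xE -tE.
move=> x xB; split; first exact: FB.
elim: prF x xB => {n F}.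
- by move=> n i x xB; rewrite tnth_map.
- by move=> n x _; exact: pi_delta (delta_vnat 0).
- move=> n F G prF IF prG IG x xB; rewrite -IF // -IG //.
  have Fx := FB _ _ _ prF xB; have Gx := FB _ _ _ prG xB.
  have UB := FB _ _ _ (pr_adjoin prF prG) xB.
  apply: V_ext => z; rewrite in_pi // in_vU in_pi // in_vpair.
  split=> [[y [yB /in_vU[yF|/in_vpair[]yG] ->]]|[[y [yB yF ->]]|[]->]].
  + by left; exists y.
  + by right; left; rewrite yG.
  + by right; left; rewrite yG.
  + by exists y; split=> //; apply/in_vU; left.
  + by exists (G x); split=> //; apply/in_vU; right; apply/in_vpair; left.
  + by exists (G x); split=> //; apply/in_vU; right; apply/in_vpair; left.
- move=> n F G P Q prF IF prG IG prP IP prQ IQ x xB.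
  rewrite -IF // -IG // -IP // -IQ //.
  have Px := FB _ _ _ prP xB; have Qx := FB _ _ _ prQ xB.
  case: asboolP => PQ; first by rewrite asboolT //; apply/pi_mem.
  by rewrite asboolF // => /(pi_mem Px Qx).
- move=> m n G F prG IG prF IF x xB; rewrite IG.
    congr G; apply: eq_from_tnth => i; rewrite tnth_map !tnth_mktuple.
    by rewrite IF.
  by move=> i; rewrite tnth_mktuple; apply: FB.
- move=> n G F prG IG FE x; case/tupleP: x => z x xB.
  have zB : z ∈ B by have := xB ord0.
  have {}xB i : tnth x i ∈ B by have := xB (lift ord0 i); rewrite tnthS.
  have uxB u : u ∈ B -> forall i, tnth [tuple of u :: x] i ∈ B.
    by move=> uB i; case: (unliftP ord0 i) => [j|] ->; rewrite ?tnthS.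
  have prF := pr_rec prG FE; have [t tE] := pr_code prF.
  have mapE u : map_tuple pi [tuple of u :: x] = [tuple of pi u :: map_tuple pi x].
    by apply: val_inj.
  elim/V_ind: z zB => z IH zB; rewrite mapE !FE.
  (* The union of the previous values is itself primitive recursive in the arguments, so it lies in
     [B] and [pi] can be computed on it. *)
  have [K prK KE] := pr_rec_union prG FE.
  have UB : vUnion (vimg (fun u => F [tuple of u :: x]) z) ∈ B.
    by rewrite -KE; apply: FB => //; exact: uxB.
  rewrite IG; last first.
    move=> i; case: (unliftP ord0 i) => [j|] ->; rewrite ?tnthS //; exact: uxB.
  congr G; apply: val_inj; congr [:: _, _ & _].
  have sB : ntuple (z :: x) ∈ B.
    by apply: hull_ntuple => y /(@tnthP _ _ [tuple of z :: x])[i ->]; exact: uxB.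
  apply: V_ext => w; rewrite in_pi // in_vUnion; split.
    move=> [y [yB /in_vUnion[_ /in_vimg[u0 u0z ->] yF] ->]].
    have u0g := tr_gamma (Bg zB) u0z.
    (* [u0] need not be in [B]; reflection replaces it by some [u] in [B] whose value also contains
       [y]. *)
    have [] := @rB' 11 isT [:: n] t _ _ _ sB yB u0g.
      by exists z, (tval x); rewrite size_tuple -(tE [tuple of u0 :: x]).
    move=> u uB [z' [s [ssz /ntuple_inj E uz yFu]]].
    have [zz' xs] : z :: tval x = z' :: s by apply: E; rewrite /= size_tuple ssz.
    subst z' s; have FuB := FB _ _ _ prF (uxB u uB).
    exists (F [tuple of pi u :: map_tuple pi x]).
      by apply/in_vimg; exists (pi u) => //; apply/pi_mem.
    rewrite -mapE -IH //; apply/pi_mem => //.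
    by rewrite (tE [tuple of u :: x]).
  move=> [_ /in_vimg[u' + ->]]; rewrite in_pi // => -[u [uB uz ->]].
  have FuB := FB _ _ _ prF (uxB u uB).
  rewrite -mapE -IH // in_pi // => -[y [yB yF ->]].
  exists y; split=> //; apply/in_vUnion; exists (F [tuple of u :: x]) => //.
  by apply/in_vimg; exists u.
Qed.

Lemma in_collapse_tuple n (x : n.-tuple V) : (forall i, tnth x i ∈ M delta') ->
  exists2 y : n.-tuple V, forall i, tnth y i ∈ B & x = map_tuple pi y.
Proof.
move=> xM; have H i : exists y, y ∈ B /\ tnth x i = pi y.
  by have /in_collapse[y] := xM i; exists y.
have /choice[f fP] := H; exists [tuple f i | i < n].
  by move=> i; rewrite tnth_mktuple; case: (fP i).
by apply: eq_from_tnth => i; rewrite tnth_map tnth_mktuple; case: (fP i).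
Qed.

Lemma sees_collapse : sees (M delta') delta.
Proof.
have tr : transitive_set (M delta').
  move=> z /in_collapse[x xB ->] w; rewrite in_pi // => -[y [yB _ ->]].
  exact: pi_collapse.
have dM : delta ∈ M delta' by rewrite -pi_kappa; apply: pi_collapse; exact: kappa_hull.
split=> //; last exact: tr dM.
move=> n F prF x /in_collapse_tuple[y yB ->].
by have [FB <-] := pi_pr prF yB; apply: pi_collapse.
Qed.

(** If a value left [Z], this would happen at a tuple in [B], whose collapse would violate closure
    of [pi Z]. *)
Lemma pr_closedV (Z : V) : Z ∈ B -> pr_closed (pi Z) -> pr_closed Z.
Proof.
move=> ZB prZ n F prF x xZ; apply: contrapT => FN.
have [t tE] := pr_code prF.
have ng (s : seq V) : {in s, forall y, y ∈ Z} -> ntuple s ∈ M gamma.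
  elim/last_ind: s => [_|s y IH sZ]; first exact: Bg (delta_hull (delta_vnat 0)).
  have yZ : y ∈ Z by apply: sZ; rewrite mem_rcons inE eqxx.
  have yg := tr_gamma (Bg ZB) yZ.
  have [->//|sN] := eqVneq s [::].
  rewrite ntuple_rcons //; apply: pr_closed_opair => //; apply: IH => w ws.
  by apply: sZ; rewrite mem_rcons inE ws orbT.
have xZ' : {in x, forall y, y ∈ Z} by move=> y /tnthP[i ->].
have [] := @rB' 12 isT [:: n] t _ _ _ ZB ZB (ng _ xZ').
  by exists x; rewrite size_tuple; split=> //; rewrite -tE.
move=> z sB [s [/= /eqP ssz zE sZ sN]]; apply: sN; rewrite zE in sB.
have {}sB := hull_ntupleE sB.
have yB i : tnth (Tuple ssz) i ∈ B by apply: sB; exact: mem_tnth.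
have [FB FE] := pi_pr prF yB.
rewrite -(tE (Tuple ssz)) -(pi_mem FB ZB) FE; apply: prZ => // i.
by rewrite tnth_map; apply/pi_mem => //; apply: sZ; exact: mem_tnth.
Qed.

(** * Badness passes between [kappa] and [delta] *)

Lemma unb_hull D : D ∈ B -> D `<=` kappa -> unb D kappa -> unb D delta.
Proof.
move=> DB Dk [_ Du]; split; first exact: hull_delta0 hB.
move=> i id; have [d [dD dk ide]] := Du i (delta_kappa id).
have dg := tr_gamma (Bg DB) dD.
have [e eB [eD ie]] := @rB' 17 isT [::] nc _ _ _ DB (delta_hull id) dg (conj dD ide).
by exists e; split=> //; apply: in_delta => //; apply: Dk.
Qed.

Lemma unb_hullV D : D ∈ B -> unb (pi D) delta -> unb D kappa.
Proof.
move=> DB [_ Du]; split.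
  by move=> E; have := delta_kappa (delta_vnat 0); rewrite E => /in_vempty.
move=> i ik; apply: contrapT => iN; have ig := tr_gamma kappa_gamma ik.
have [j jB [jk jN]] := @rB' 18 isT [::] nc _ _ _ DB DB ig (conj ik iN).
have [d [dD dd jd]] := Du j (in_delta jB jk).
apply: jN; exists d; split=> //; last exact: delta_kappa.
by move: dD; rewrite -{1}(pi_delta dd); apply: (proj1 (pi_mem _ _)) => //; exact: delta_hull.
Qed.

Lemma restr_restr A m d : d ∈ delta -> restr (restr A m delta) m d = restr A m d.
Proof.
move=> dd; apply/funext => n; apply: V_ext => z; rewrite !in_vI.
split=> [[[]]//|[zA zd]]; split=> //; split=> //; apply: vexp_sub zd; exact: od.1.
Qed.

Lemma good_restr phi A d : d ∈ delta ->
  good N phi (restr A (mA phi) delta) d <-> good N phi A d.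
Proof. by move=> dd; rewrite /good restr_restr. Qed.

Lemma unb_vI D d : d ∈ delta -> unb (vI D delta) d <-> unb D d.
Proof.
move=> dd; split=> -[d0 Du]; split=> // i /Du[e [eD ed ie]]; exists e; split=> //.
  by case/in_vI: eD.
by apply/in_vI; split=> //; apply: od.1 dd _ ed.
Qed.

(** A challenge [X] in the collapse is the image of one in [B], for which reflection finds the
    response in [B]. *)
Lemma models_hull phi A : vseq A ∈ B -> arcode (mA phi) ∈ B ->
  (forall n, A n `<=` vexp kappa (mA phi n)) ->
  pi12_models_in (M gamma) kappa A phi ->
  pi12_models_in (M delta') delta (restr A (mA phi) delta) phi.
Proof.
move=> AB mB Ak [_ mod]; split; first by rewrite -pi_vseq //; exact: pi_collapse.
move=> _ /in_collapse[X XB ->] Xd; have Xk := pi_subsetV XB Xd.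
have [Y [Yg Yk Ysat]] := mod X (Bg XB) Xk.
have [] := @rB' 14 isT [::] (scode phi) _ _ Y (hull_opair XB AB) mB Yg.
  by exists phi, X, A.
move=> Z ZB [phi' [X' [A' [E /opair_inj[<- /vseq_inj <-]]]]] /arcode_inj mE.
have {mE} <- := scode_inj mE E; move=> [Zk Zsat].
exists (pi Z); split; [exact: pi_collapse|by rewrite (pi_subset ZB Zk) => z /in_vI[]|].
rewrite (pi_subset ZB Zk) (pi_subset XB Xk).
by apply: (iffLR (sat_pi _ XB ZB AB mB _)) Zsat; case.
Qed.

(** The downward direction. Clause [bad_good] carries over because cutting [A] and [D] to [delta]
    changes nothing at points below [delta]. *)
Lemma bad_hull phi A D : D ∈ B -> vseq A ∈ B -> arcode (mA phi) ∈ B ->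
  bad M N S kappa gamma phi A D ->
  bad M N S delta delta' phi (restr A (mA phi) delta) (vI D delta).
Proof.
move=> DB AB mB [_ _ _ Dk Du Ak mod Ng].
have DE : pi D = vI D delta by apply: (@pi_subset 1).
split.
- exact: sees_collapse.
- by rewrite -pi_arcode //; exact: pi_collapse.
- by rewrite -DE; exact: pi_collapse.
- by move=> z /in_vI[].
- have [d0 Du'] := unb_hull DB Dk Du; split=> // i /Du'[d [dD dd id]].
  by exists d; split=> //; apply/in_vI.
- by move=> n z /in_vI[].
- exact: models_hull.
move=> d dd dS; rewrite unb_vI // good_restr //; apply: Ng => //.
exact: delta_kappa.
Qed.

Hypothesis gamma_ordinal : forall x, x ∈ M gamma -> ordinal x -> x ∈ gamma.
Hypothesis gamma_transitive : forall x, x ∈ gamma -> transitive_set (M x).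

(** The upward direction. [M xi] is the collapse of some [M zeta] in [B], and the parameters have
    preimages in [B]. If [zeta] were not bad for [kappa], reflection would put a counterexample into
    [B] and thus refute badness of [xi]. *)
Lemma bad_hullV xi phi A' D' : xi ∈ delta' -> bad M N S delta xi phi A' D' ->
  exists zeta A D, zeta ∈ gamma /\ bad M N S kappa zeta phi A D.
Proof.
move=> /(hull_filt hB)[zeta [zB oz ZB zE ZE]] [[trx prx dx _] mx D'x D'd D'u A'd [A'x mod] Ng].
have zg := gamma_ordinal (Bg zB) oz; have trz := gamma_transitive zg.
rewrite -ZE in prx dx mx D'x A'x mod; set Z := M zeta in ZB ZE trz prx dx mx D'x A'x mod *.
have kZ : kappa ∈ Z by apply/pi_mem => //; [exact: kappa_hull|rewrite pi_kappa].
have [c [cB cZ cE]] := iffLR (in_pi _ ZB) mx.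
have mE := pi_arcodeV cB (esym cE); subst c.
have [D [DB DZ DE]] := iffLR (in_pi _ ZB) D'x; subst D'.
have [a [aB aZ aE]] := iffLR (in_pi _ ZB) A'x.
have [A [AE Ak A'E]] := pi_vseqV aB (esym aE) A'd; subst a A'.
have Dk : D `<=` kappa := @pi_subsetV 1 D DB D'd.
have DE : pi D = vI D delta by apply: (@pi_subset 1).
exists zeta, A, D; split=> //; split=> //.
- by split=> //; [exact: pr_closedV|exact: trz].
- exact: unb_hullV.
- split=> // X XZ Xk; apply: contrapT => YN.
  have Xg := tr_gamma (Bg ZB) XZ.
  have [] := @rB' 15 isT [::] (scode phi) _ _ X (hull_opair aB cB) ZB Xg.
    exists phi, A; split=> // Y YZ [Yk Ysat]; apply: YN; exists Y; split=> //.
  move=> X1 X1B [phi' [A1 [E /opair_inj[/vseq_inj <- /arcode_inj mE]]]].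
  have {mE E} <- := scode_inj mE E; move=> X1Z X1k X1N.
  have X1E := pi_subset X1B X1k.
  have [||_ [/(iffLR (in_pi _ ZB))[Y [YB YZ ->]] Yd Ysat]] := mod (pi X1).
  - exact/pi_mem.
  - by rewrite X1E => z /in_vI[].
  have Yk := pi_subsetV YB Yd; apply: (X1N Y YZ); split=> //.
  apply: (iffRL (sat_pi _ X1B YB aB cB _)); first by case.
  by rewrite -X1E -(pi_subset YB Yk).
- move=> d dk dS du dg; have dga := tr_gamma kappa_gamma dk.
  have [] := @rB' 16 isT [::] (scode phi) _ _ d (hull_opair aB cB) DB dga.
    by exists phi, A.
  move=> d1 d1B [phi' [A1 [E /opair_inj[/vseq_inj <- /arcode_inj mE] [d1k d1S]]]].
  have {mE E} <- := scode_inj mE E; move=> d1u d1g; have d1d := in_delta d1B d1k.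
  apply: (Ng d1) => //; first by rewrite DE unb_vI.
  by rewrite good_restr.
Qed.

(** Since [kappa] is a cardinal, this excludes injections of [delta] into smaller ordinals in
    [M delta'], as largeness of [delta'] requires. *)
Lemma inj_hull e nu : e ∈ M delta' -> nu ∈ delta -> inj_graph e delta nu ->
  exists e', inj_graph e' kappa nu.
Proof.
move=> /in_collapse[f fB ->] nd [tot inj]; exists f.
have nB := delta_hull nd.
have nud v : v ∈ nu -> v ∈ delta by apply: od.1 nd _.
have mem u v : u ∈ delta -> v ∈ delta -> opair u v ∈ pi f <-> opair u v ∈ f.
  move=> ud vd; have uB := delta_hull ud; have vB := delta_hull vd.
  by have := pi_mem (hull_opair uB vB) fB; rewrite pi_opair // (pi_delta ud) (pi_delta vd).
split=> [x xk|x x' y xk x'k yn xy x'y]; apply: contrapT => xN.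
  have xg := tr_gamma kappa_gamma xk.
  have [z zB [zk]] := @rB' 19 isT [::] nc _ _ _ fB nB xg (conj xk xN).
  have zd := in_delta zB zk.
  by have [v vn zv] := tot z zd; case; exists v => //; apply/mem => //; exact: nud.
have tg u : u ∈ kappa -> u ∈ M gamma by apply: tr_gamma.
have zg : ntuple [:: x; x'; y] ∈ M gamma.
  by do 2?[apply: pr_closed_opair => //]; apply: tg => //; apply: delta_kappa; exact: nud.
have [] := @rB' 20 isT [::] nc _ _ _ fB nB zg; first by exists x, x', y.
move=> z zB [u [u' [v [zE [uk u'k vn] uN uv u'v]]]]; rewrite zE in zB.
have sB := hull_ntupleE zB.
have ud : u ∈ delta by apply: in_delta => //; apply: sB; rewrite !inE eqxx.
have u'd : u' ∈ delta by apply: in_delta => //; apply: sB; rewrite !inE eqxx orbT.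
by apply: uN; apply: (inj u u' v) => //; apply/mem => //; exact: nud.
Qed.

End HullTransfer.

(** * The guessing sequence *)

Lemma inj_graph_card e (alpha nu : V) : inj_graph e alpha nu -> alpha #<= nu.
Proof.
move=> [tot inj]; have /choice[f fP] x : exists y, x ∈ alpha -> y ∈ nu /\ opair x y ∈ e.
  have [xa|xN] := pselect (x ∈ alpha); last by exists vempty => /xN.
  by have [y yn xy] := tot x xa; exists y.
apply: (@card_leI _ _ _ f) => [x /fP[]//|x y xa ya fxy].
have [xn xe] := fP x xa; have [yn ye] := fP y ya.
by apply: (inj x y (f x)) => //; rewrite fxy.
Qed.

Lemma bad_ext M N N' S alpha xi phi A D : (forall d, d ∈ alpha -> N d = N' d) ->
  bad M N S alpha xi phi A D -> bad M N' S alpha xi phi A D.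
Proof.
move=> NN' [? ? ? ? ? ? ? Ng]; split=> // d da dS du.
by rewrite /good -NN' //; apply: Ng.
Qed.

Section Main.
Variables (kappa S : V) (M : V -> V).
Local Notation kappa' := (vcard_succ kappa).
Local Notation H := (Hset kappa').
Hypothesis kappa_reg : regular_uncountable kappa.
Hypothesis nfM : nice_filtration kappa' M H.
Hypothesis M_kappa : M kappa = Hset kappa :> set V.
Hypothesis lccM : witnesses_LCC kappa kappa' kappa' M.
Hypothesis statS : stationary kappa S.

Let ok := ord_kappa kappa_reg.
Let ck := card_kappa kappa_reg.
Let kk' : kappa ∈ kappa' := kappa_kappa' kappa_reg.
Let ok' : ordinal kappa' := ord_kappa' kappa.

Lemma kappa_sub_succ x : x ∈ kappa -> x ∈ kappa'.
Proof. exact: ok'.1 kk' x. Qed.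

Lemma limit_kappa : limit_ordinal kappa.
Proof. by split=> // x; apply: vsucc_kappa. Qed.

Lemma kappa_neq0 : kappa <> vempty.
Proof. by move=> E; have := vnat_kappa kappa_reg 0; rewrite E => /in_vempty. Qed.

Lemma M_lt b : b ∈ kappa -> M b #< kappa.
Proof.
move=> bk; have : M b ∈ M kappa by apply: (M_in nfM bk kk').
rewrite M_kappa => /(card_le_lt_trans _); apply.
by apply: subset_card_le; apply: trcl_sub.
Qed.

Lemma Hkappa_M x : Hset kappa x -> exists2 b, b ∈ kappa & x ∈ M b.
Proof.
by rewrite -M_kappa => /(M_limit nfM kk' limit_kappa kappa_neq0).
Qed.

Lemma Hkappa_intro (y : V) : y `<=` Hset kappa -> y #< kappa -> Hset kappa y.
Proof.
move=> yH yk; have /choice[b bP] x : exists b, x ∈ y -> b ∈ kappa /\ x ∈ M b.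
  have [/yH/Hkappa_M[b bk xb]|xN] := pselect (x ∈ y); first by exists b.
  by exists vempty => /xN.
have [x /bP[]//|c ck' cP] := @kappa_bound _ kappa_reg y b yk.
have yc : y `<=` M c.
  move=> x xy; have [bk xb] := bP _ xy.
  have oc := ordinal_in ok ck'.
  apply: (M_sub nfM _ _ (kappa_sub_succ ck') xb); last exact: ordinal_in ok bk.
  exact: oc.1 (cP x xy).
apply: card_le_lt_trans (M_lt ck'); apply: subset_card_le.
exact: trcl_min (M_transitive nfM (kappa_sub_succ ck')) yc.
Qed.

(** Primitive recursive closure of [M gamma] comes with reflection: [H] is closed, and [R_pr]
    reflects the values. *)
Lemma gamma_ex N p : H p -> exists gamma, [/\ gamma ∈ kappa', kappa ∈ gamma, p ∈ M gamma,
  pr_closed (M gamma) & reflects_all kappa S N (M gamma) H].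
Proof.
move=> Hp; have [g [gk kg pg rg]] := M_reflects kappa_reg nfM M_kappa (relation_nat kappa S N) Hp.
have {}rg := reflects_relation_nat rg; exists g; split=> //.
have gH := M_H nfM gk.
have vp x y : x ∈ M g -> y ∈ M g -> vpair x y ∈ M g.
  move=> xg yg; have [] := rg 0 isT [::] (GenTree.Leaf 0) x y xg yg.
    by exists (vpair x y) => //; apply: (H_vpair kappa_reg nfM M_kappa); apply: gH.
  by move=> z zg <-.
have op x y : x ∈ M g -> y ∈ M g -> opair x y ∈ M g.
  by move=> xg yg; apply: (vp); apply: vp.
have g0 : vempty ∈ M g.
  have tg := (ordinal_in ok' gk).1.
  apply: (sub_M nfM gk); apply: tg kg _ _; exact: (vnat_kappa kappa_reg 0).
have nt (s : seq V) : {in s, forall x, x ∈ M g} -> ntuple s ∈ M g.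
  elim/last_ind: s => // s y IH sg.
  have yg : y ∈ M g by apply: sg; rewrite mem_rcons inE eqxx.
  have [->//|sN] := eqVneq s [::].
  rewrite ntuple_rcons //; apply: op => //; apply: IH => w ws.
  by apply: sg; rewrite mem_rcons inE ws orbT.
move=> n F prF x xg; have [t tE] := pr_code prF.
have xg' : ntuple x ∈ M g by apply: nt => y /tnthP[i ->].
have [] := rg 10 isT [:: n] t _ _ xg' xg'.
  exists (F x); first by apply: (H_pr_closed kappa_reg nfM M_kappa prF) => i; apply: gH.
  by exists x; rewrite size_tuple.
move=> z zg [s [ssz /ntuple_inj xs zE]].
by rewrite tE xs ?size_tuple // -zE.
Qed.

Lemma hull_club N gamma p : gamma ∈ kappa' -> kappa ∈ gamma -> pr_closed (M gamma) ->
  p ∈ M gamma -> exists2 E, club kappa E & forall delta, delta ∈ E ->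
    exists delta' B pi, [/\ hull kappa M gamma delta delta' B pi, p ∈ B &
      reflects_all kappa S N B (M gamma)].
Proof.
move=> gk kg prg pg.
have [|E clE EP] := hull_ex kappa_reg nfM M_kappa lccM gk kg _ (relation_nat kappa S N) pg.
  by move=> x y; apply: pr_closed_opair.
exists E => // d /EP[d' [B [pi [hB pB rB]]]]; exists d', B, pi; split=> //.
exact: reflects_relation_nat.
Qed.

Lemma delta_sub_delta' gamma delta delta' B pi : hull kappa M gamma delta delta' B pi ->
  sees (M delta') delta -> delta `<=` delta'.
Proof.
move=> hB [_ _ _ dM] x xd.
apply/(M_ordinal nfM _ (kappa_sub_succ (hull_delta' hB))); split; first exact: dM.
exact: ordinal_in (hull_limit hB).1 xd.
Qed.

(** The collapse of a hull whose [delta] lies above [alpha] and [eta] serves as [M xi]. *)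
Lemma sees_ex alpha eta : alpha ∈ kappa -> eta ∈ kappa ->
  exists xi, [/\ xi ∈ kappa, eta `<=` xi & sees (M xi) alpha].
Proof.
move=> ak ek; have [z [zk az ez]] := kappa_max kappa_reg ak ek.
have [g [gk kg pg prg _]] := gamma_ex (fun=> vempty) (H_vempty kappa_reg nfM M_kappa).
have [E [_ Eunb _] EP] := hull_club (fun=> vempty) gk kg prg pg.
have [d dE zd] := Eunb z zk; have [d' [B [pi [hB _ rB]]]] := EP d dE.
have kMg := sub_M nfM gk kg.
have sd := sees_collapse hB (M_transitive nfM gk) prg kMg rB.
have od := (hull_limit hB).1; have dd' := delta_sub_delta' hB sd.
have od' := ordinal_in ok (hull_delta' hB).
have ad : alpha ∈ d by apply: od.1 zd _ az.
have ed : eta ∈ d by apply: od.1 zd _ ez.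
exists d'; split; first exact: hull_delta' hB.
  exact: od'.1 (dd' _ ed).
case: sd => tM prM dM dsM; split=> //; first exact: dsM.
exact: tM (dsM _ ad).
Qed.

(** Holds for the heights [xi] of the collapses of hulls [B] with [B ∩ kappa = alpha]. *)
Definition large (alpha xi : V) : Prop := (M xi #<= alpha) /\
  forall e nu, e ∈ M xi -> nu ∈ alpha -> ~ inj_graph e alpha nu.

Lemma large_bounded : exists2 alpha0, alpha0 ∈ kappa & forall alpha, alpha ∈ kappa ->
  alpha0 ∈ alpha -> exists2 eta, eta ∈ kappa & forall xi, xi ∈ kappa -> large alpha xi -> xi ∈ eta.
Proof.
(* First case: some [l] below [kappa] has the largest size. Then an injection of [alpha] into [l]
   belongs to some [M eta], so no height from [eta] on is large. *)
have [[l lk lP]|lN] := pselect (exists2 l, l ∈ kappa & forall nu, nu ∈ kappa -> nu #<= l).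
  exists l => // a ak la; have [f fl finj] := card_leE (lP a ak).
  have : Hset kappa (vfun a f).
    apply: Hkappa_intro; last first.
      apply: card_le_lt_trans (card_elem ck ak).
      by apply: (@card_le_surj _ _ _ (fun x => opair x (f x))) => x /in_vfun[y ya ->]; exists y.
    move=> x /in_vfun[y ya ->]; apply: (Hkappa_opair kappa_reg).
      exact: ok.1 ak _ ya.
    exact: ok.1 lk _ (fl _ ya).
  move=> /Hkappa_M[eta ek fe]; exists eta => // xi xk [_ xN]; apply: contrapT => xe.
  have oe := ordinal_in ok ek; have ox := ordinal_in ok xk.
  have fx := M_sub nfM (ordinal_notin ox oe xe) oe (kappa_sub_succ xk) fe.
  apply: (xN _ l fx la); split=> [x xa|x x' y xa x'a yl].
    by exists (f x); [exact: fl|apply/in_vfun; exists x].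
  move=> /in_vfun[z za /opair_inj[xz yz]] /in_vfun[z' z'a /opair_inj[xz' yz']].
  by subst z z'; apply: finj => //; rewrite -yz.
(* Second case: there is [nu] below [kappa] that does not inject into [alpha]. A height [xi] above
   or equal to [nu] makes [M xi] too big to be large. *)
exists vempty; first exact: (vnat_kappa kappa_reg 0).
move=> a ak _.
have [nu nk nN] : exists2 nu, nu ∈ kappa & ~ (nu #<= a).
  apply: contrapT => N; apply: lN; exists a => // nu nk; apply: contrapT => nN.
  by apply: N; exists nu.
exists nu => // xi xk [Mx _]; apply: contrapT => xn; apply: nN.
apply: card_le_trans Mx; apply: subset_card_le => x xnu.
have on := ordinal_in ok nk; have ox := ordinal_in ok xk.
apply: (sub_M nfM (kappa_sub_succ xk)); exact: ordinal_notin ox on xn _ xnu.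
Qed.

Lemma fallback_ex : exists2 alpha0, alpha0 ∈ kappa & forall alpha, alpha ∈ kappa ->
  exists eta, [/\ eta ∈ kappa, sees (M eta) alpha &
    alpha0 ∈ alpha -> forall xi, xi ∈ kappa -> large alpha xi -> xi ∈ eta].
Proof.
have [a0 a0k a0P] := large_bounded; exists a0 => // a ak.
have [e ek eP] : exists2 e, e ∈ kappa &
    a0 ∈ a -> forall xi, xi ∈ kappa -> large a xi -> xi ∈ e.
  have [/(a0P a ak)[e ek eP]|aN] := pselect (a0 ∈ a); first by exists e.
  by exists a.
have [h [hk eh sh]] := sees_ex ak ek; exists h; split=> // a0a xi xk lx.
by apply: eh; apply: eP.
Qed.

Definition is_bad (N : V -> V) (alpha xi : V) : Prop :=
  exists phi A D, bad M N S alpha xi phi A D.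

Definition stage (alpha0 : V) (N : V -> V) (alpha v : V) : Prop :=
  (exists xi, [/\ xi ∈ kappa, is_bad N alpha xi,
     forall zeta, zeta ∈ xi -> ~ is_bad N alpha zeta & v = M xi]) \/
  ((forall xi, xi ∈ kappa -> ~ is_bad N alpha xi) /\
   exists eta, [/\ eta ∈ kappa, sees (M eta) alpha, v = M eta &
     alpha0 ∈ alpha -> forall xi, xi ∈ kappa -> large alpha xi -> xi ∈ eta]).

Lemma guess_ex : exists2 alpha0, alpha0 ∈ kappa & exists N : V -> V,
  forall alpha, alpha ∈ kappa -> stage alpha0 N alpha (N alpha).
Proof.
have [a0 a0k a0P] := fallback_ex; exists a0 => //.
have /choice[G GP] (q : V * (V -> V)) : exists v, q.1 ∈ kappa -> stage a0 q.2 q.1 v.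
  case: q => a R /=; have [ak|aN] := pselect (a ∈ kappa); last by exists vempty => /aN.
  have [Ne|Ne] := pselect (exists xi, xi ∈ kappa /\ is_bad R a xi).
    have [xi [xk xb] xmin] := @V_min (fun xi => xi ∈ kappa /\ is_bad R a xi) Ne.
    exists (M xi) => _; left; exists xi; split=> // z zx zb; apply: (xmin z) => //.
    by split=> //; apply: ok.1 xk _ zx.
  have [eta [ek se eP]] := a0P a ak; exists (M eta) => _; right; split; last by exists eta.
  by move=> xi xk xb; apply: Ne; exists xi.
have [N NE] := mem_rec (fun a R => G (a, R)); exists N => a ak.
have gE d : d ∈ a -> (if `[< d ∈ a >] then N d else vempty) = N d by move=> da; rewrite asboolT.
(* The truncated sequence agrees with [N] below [a], hence has the same bad heights for [a]. *)
have bE xi : is_bad (fun d => if `[< d ∈ a >] then N d else vempty) a xi <-> is_bad N a xi.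
  split=> -[phi [A [D bd]]]; exists phi, A, D; apply: bad_ext bd => d da.
    exact: gE.
  by rewrite gE.
have := GP (a, fun d => if `[< d ∈ a >] then N d else vempty) ak; rewrite -NE /=.
case=> [[xi [xk xb xmin xE]]|[xN [eta etaP]]].
  left; exists xi; split=> //; first exact/bE.
  by move=> z zx /bE; apply: xmin.
by right; split; [move=> xi xk /bE; apply: xN|exists eta].
Qed.

Lemma in_gamma gamma x : gamma ∈ kappa' -> x ∈ M gamma -> ordinal x -> x ∈ gamma.
Proof. by move=> gk xg ox; apply/(M_ordinal nfM _ gk). Qed.

Lemma not_bad_kappa alpha0 N :
  (forall alpha, alpha ∈ kappa -> stage alpha0 N alpha (N alpha)) ->
  forall gamma, gamma ∈ kappa' -> ~ is_bad N kappa gamma.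
Proof.
move=> NP g1 g1k g1b.
have [g [gk [phi [A [D bd]]]] gmin] :=
  @V_min (fun g => g ∈ kappa' /\ is_bad N kappa g) (ex_intro _ g1 (conj g1k g1b)).
have [[tg prg kMg ksg] mg Dg Dk Du Ak mod Ng] := bd.
have kg : kappa ∈ g by apply: in_gamma.
have [Ag _] := mod.
have pg : opair (opair D (vseq A)) (arcode (mA phi)) ∈ M g by do !apply: pr_closed_opair => //.
have [E clE EP] := hull_club N gk kg prg pg.
have [_ /(_ E clE)[d dE dS]] := statS.
have [d' [B [pi [hB pB rB]]]] := EP d dE.
have DAB := hull_fst hB tg rB pB; have mB := hull_snd hB tg rB pB.
have DB := hull_fst hB tg rB DAB; have AB := hull_snd hB tg rB DAB.
have dk := hull_delta hB; have d'k := hull_delta' hB.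
have bd' := bad_hull hB tg prg kMg rB DB AB mB bd.
(* Minimality of [g] for [kappa] becomes minimality of [d'] for [d]. *)
have gmin' xi : xi ∈ d' -> ~ is_bad N d xi.
  move=> xd [psi [A' [D' bx]]].
  have [||z [A1 [D1 [zg bz]]]] := bad_hullV hB tg prg kMg rB _ _ xd bx.
  - by move=> x; apply: in_gamma.
  - by move=> x xg; apply: (M_transitive nfM); apply: ok'.1 gk _ xg.
  apply: (gmin z) => //; split; first exact: ok'.1 gk _ zg.
  by exists psi, A1, D1.
have Nd : N d = M d'.
  case: (NP d dk) => [[xi [xk xb xmin ->]]|[/(_ d' d'k)[]]]; last first.
    by exists phi, (restr A (mA phi) d), (vI D d).
  case: (ordinal_total (ordinal_in ok xk) (ordinal_in ok d'k)) => [->//|/gmin'//|/xmin[]].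
  by exists phi, (restr A (mA phi) d), (vI D d).
(* [N d = M d'] satisfies the sentence at [d], and [d] is a limit point of [D] in [S]: this is what
   [D] forbids. *)
apply: (Ng d dk dS); last first.
  split; first by rewrite Nd; exact: hull_card hB.
  by rewrite Nd; exact: bad_models bd'.
have [d0 du] := bad_unb bd'; split=> // i /du[e [/in_vI[eD _] ed ie]].
by exists e.
Qed.

Lemma Dl_star_kappa : Dl_star kappa S.
Proof.
have [a0 a0k [N NP]] := guess_ex; exists N.
have Nb := not_bad_kappa NP; have [Sk Sst] := statS.
split.
- move=> a /Sk ak; case: (NP a ak) => [[xi [xk [phi [A [D bd]]] _ ->]]|[_ [eta [ek se -> _]]]].
    by split; [exact: M_lt|exact: bad_sees bd].
  by split; [exact: M_lt|].
- move=> X Xk.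
  have HX : H X := H_sub kappa_reg nfM M_kappa (H_ordinal nfM kk') Xk.
  have Ha0 : H a0 := H_ordinal nfM (kappa_sub_succ a0k).
  (* [a0] is put into the hull to get [a0] below [d], where the fallback bounds all large
     heights. *)
  have [g [gk kg pg prg _]] := gamma_ex N (H_opair kappa_reg nfM M_kappa HX Ha0).
  have kMg := sub_M nfM gk kg; have tg := M_transitive nfM gk.
  have [E clE EP] := hull_club N gk kg prg pg.
  exists E => // d dE dS; have [d' [B [pi [hB pB rB]]]] := EP d dE.
  have XB := hull_fst hB tg rB pB; have a0B := hull_snd hB tg rB pB.
  have dk := hull_delta hB; have d'k := hull_delta' hB; have od' := ordinal_in ok d'k.
  have Xd : vI X d ∈ M d'.
    rewrite -(vexp1 d) -(pi_subset (m := 1) hB tg prg rB XB Xk).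
    exact: pi_collapse hB _ XB.
  have nb xi : xi ∈ d' -> ~ is_bad N d xi.
    move=> xd [psi [A' [D' bx]]].
    have [||z [A1 [D1 [zg bz]]]] := bad_hullV hB tg prg kMg rB _ _ xd bx.
    - by move=> x; apply: in_gamma.
    - by move=> x xg; apply: (M_transitive nfM); apply: ok'.1 gk _ xg.
    by apply: (Nb z); [apply: ok'.1 gk _ zg|exists psi, A1, D1].
  (* In both cases [N d] has height at least [d']: bad heights for [d] are not below [d'], and the
     fallback exceeds the large height [d']. *)
  case: (NP d dk) => [[xi [xk xb _ ->]]|[_ [eta [ek _ -> etaP]]]].
    apply: (M_sub nfM _ od' (kappa_sub_succ xk) Xd).
    by apply: ordinal_notin (ordinal_in ok xk) od' _ => /nb.
  have d'e : d' ∈ eta.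
    apply: etaP => //; first exact: in_delta hB _ a0B a0k.
    split; first exact: card_eq_leL (hull_card hB).
    move=> e nu ed' nud ie.
    have [e' /inj_graph_card kn] := inj_hull hB tg prg kMg rB ed' nud ie.
    have nuk : nu ∈ kappa by apply: ok.1 dk _ nud.
    by have [_] := card_elem ck nuk; apply.
  apply: (M_sub nfM _ od' (kappa_sub_succ ek) Xd).
  exact: (ordinal_in ok ek).1 d'e.
- move=> phi A Ak mod; split; first by move=> x /in_vsep[/Sk].
  (* If a club [C] misses all reflection points, then [C] plays the part of [D] and some [gamma]
     becomes bad for [kappa]. *)
  move=> C clC; apply: contrapT => CN.
  have [Ck Cu Cl] := clC.
  have HC : H C := H_sub kappa_reg nfM M_kappa (H_ordinal nfM kk') Ck.
  have Hm : H (arcode (mA phi)).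
    by apply: (H_vseq kappa_reg nfM M_kappa) => n; exact: (H_vnat kappa_reg nfM).
  have HA : H (vseq A) by case: mod.
  have [g [gk kg pg prg rg]] := gamma_ex N (H_opair kappa_reg nfM M_kappa
    (H_opair kappa_reg nfM M_kappa HC HA) Hm).
  have kMg := sub_M nfM gk kg; have tg := M_transitive nfM gk.
  have [CAg mg] := opair_gamma tg pg; have [Cg Ag] := opair_gamma tg CAg.
  apply: (Nb g gk); exists phi, A, C; split=> //.
  + by split=> //; exact: tg kMg.
  + split; first exact: kappa_neq0.
    by move=> i /Cu[b bC ib]; exists b; split=> //; exact: Ck.
  + split=> // X Xg Xk; have [Y [HY Yk Ysat]] := mod.2 X (M_H nfM gk Xg) Xk.
    (* The response [Y] is found in [H]; reflection moves it into [M g]. *)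
    have [] := rg 14 isT [::] (scode phi) (opair X (vseq A)) (arcode (mA phi)).
    * by apply: pr_closed_opair.
    * by [].
    * by exists Y => //; exists phi, X, A.
    move=> Z Zg [phi' [X' [A' [E /opair_inj[<- /vseq_inj <-]]]]] /arcode_inj mE.
    by have {mE} <- := scode_inj mE E; move=> [Zk Zsat]; exists Z.
  (* Limit points of [C] belong to [C], so a good one in [S] would be a reflection point in [C]. *)
  + move=> d dk dS [d0 du] gd; apply: CN; exists d; last exact/in_vsep.
    have od := ordinal_in ok dk.
    apply: (Cl d dk _ d0) => [|i /du[b [bC bd ib]]]; last by exists b.
    split=> // y yd; have [b [_ bd yb]] := du y yd.
    have ob := ordinal_in od bd.
    apply: (ordinal_sub_in (ordinal_vsucc (ordinal_in od yd)) ob od _ bd).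
    by move=> z /in_vsucc[|->//]; exact: ob.1 yb z.
Qed.

End Main.

Theorem theorem2p24 (kappa : V) (M : V -> V) (a : V) (Theta : fml set_language 3) :
  regular_uncountable kappa ->
  nice_filtration (vcard_succ kappa) M (Hset (vcard_succ kappa)) ->
  eventually_slow kappa M ->
  witnesses_LCC kappa (vcard_succ kappa) (vcard_succ kappa) M ->
  a `<=` kappa ->
  strict_well_order (Hset (vcard_succ kappa))
    (fun x y => sat (set_structure (Hset (vcard_succ kappa))) Theta
                  [tuple x; y; a]) ->
  forall S : V, stationary kappa S -> Dl_star kappa S.
Proof.
move=> kappa_reg nfM [mu [_ muk slow]] lccM _ _ S statS.
apply: (Dl_star_kappa kappa_reg nfM _ lccM statS).
(* Slowness is used at [theta = kappa]. *)
by apply: slow => //; [case: kappa_reg|right].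
Qed.
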